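(* Let $\beta>1$ be a Salem number, and let $V_\beta\subset\ell^\infty(\mathbb{Z},\mathbb{Z})$ be the corresponding two-sided beta-shift space. For every $\varepsilon>0$ there exists a $\mathsf{d}$-bounded shift-invariant probability measure $\nu$ on $V_\beta$ with $h_\nu(\sigma_\beta)>\log\beta-\varepsilon$, where $\sigma_\beta=\bar\sigma|_{V_\beta}$ is the beta-shift.
   Context: A Salem number is an algebraic unit $\beta>1$ whose other conjugates all have absolute value $\le1$, with at least one conjugate of absolute value $1$. Let $f=f_0+\dots+f_mu^m\in\mathbb{Z}[u^{\pm1}]$ be its minimal polynomial ($f_m=1$). Let $\Omega_f\subset\mathbb{C}$ be the set of roots of $f$, and $\Omega_f^-$, $\Omega_f^{(0)}$, $\Omega_f^+$ the sets of roots of absolute value $<1$, $=1$, $>1$, respectively. Beta-shift: let $T_\beta x=\beta x \pmod 1$, and for $x\in[0,1)$ let $e_\beta(x)=(e_\beta(x)_n)_{n\ge1}$ with $e_\beta(x)_n=\beta T_\beta^{n-1}x-T_\beta^nx$. Let $V_\beta^+$ be the closure of $\{e_\beta(x):x\in[0,1)\}$ (product topology), and $V_\beta=\{v\in\ell^\infty(\mathbb{Z},\mathbb{Z}):(v_{n+1},v_{n+2},\dots)\in V_\beta^+\text{ for every }n\in\mathbb{Z}\}$. $\ell^\infty(\mathbb{Z},\mathbb{R})$ is the space of bounded real sequences, with the topology of coordinatewise convergence; $\ell^\infty(\mathbb{Z},\mathbb{Z})$ is the subgroup of integer-valued sequences. The shift is $(\bar\sigma w)_n=w_{n+1}$, and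 $f(\bar\sigma)=\sum_{j=0}^m f_j\bar\sigma^j$. Put $W_f^{(0)}=\{w\in\ell^\infty(\mathbb{Z},\mathbb{R}): f(\bar\sigma)w=0\}$, a finite-dimensional real vector space (with its usual topology). Write $\frac1{f(u)}=\frac1{f_m}\sum_{\omega\in\Omega_f}\frac{b_\omega}{u-\omega}$ with $b_\omega\in\mathbb{C}$ and define $w^{\Delta_+},w^{\Delta_-}\in\ell^\infty(\mathbb{Z},\mathbb{R})$ by $w^{\Delta_+}_n=\frac1{f_m}\sum_{\omega\in\Omega_f^-}b_\omega\omega^{n-1}$ if $n\ge1$, $w^{\Delta_+}_n=-\frac1{f_m}\sum_{\omega\in\Omega_f^{(0)}\cup\Omega_f^+}b_\omega\omega^{n-1}$ if $n\le0$; $w^{\Delta_-}_n=\frac1{f_m}\sum_{\omega\in\Omega_f^-\cup\Omega_f^{(0)}}b_\omega\omega^{n-1}$ if $n\ge1$, $w^{\Delta_-}_n=-\frac1{f_m}\sum_{\omega\in\Omega_f^+}b_\omega\omega^{n-1}$ if $n\le0$. For $v\in\ell^\infty(\mathbb{Z},\mathbb{Z})$ put $\bar\xi^*(v)=\sum_{n\ge0}v_n\bar\sigma^{-n}w^{\Delta_-}+\sum_{n<0}v_n\bar\sigma^{-n}w^{\Delta_+}$ (coordinatewise convergent; a real sequence of at most linear growth, to which $\bar\sigma$ is extended by the same formula). For $n\in\mathbb{Z}$ put $\mathsf{d}(n,v)=\bar\sigma^n\bar\xi^*(v)-\bar\xi^*(\bar\sigma^nv)\in W_f^{(0)}$. A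 shift-invariant probability measure $\nu$ on $\ell^\infty(\mathbb{Z},\mathbb{Z})$ (in particular one on $V_\beta$) is $\mathsf{d}$-bounded if there exists a compact subset $C\subset W_f^{(0)}$ with $\nu(\{v:\mathsf{d}(k,v)\in C\text{ for every }k\in\mathbb{Z}\})=1$. $h_\nu$ denotes measure-theoretic entropy. *)

(* Defs.v *)
From HB Require Import structures.
From mathcomp Require Import all_boot all_order all_algebra.
From mathcomp Require Import complex.
From mathcomp Require Import all_classical all_reals all_analysis.
Set Implicit Arguments.
Unset Strict Implicit.
Unset Printing Implicit Defensive.
Import Order.TTheory GRing.Theory Num.Theory.
Import numFieldNormedType.Exports.
Local Open Scope classical_set_scope.
Local Open Scope ring_scope.

Section SalemNumbers.
Variable R : realType.

(* Minimal polynomial over Q; for an algebraic integer it has integer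
   coefficients, so it is represented in Z[u]. *)
Definition is_minpoly (beta : R) (f : {poly int}) : Prop :=
  [/\ f \is monic,
      irreducible_poly (map_poly intr f : {poly rat}) &
      root (map_poly intr f : {poly R}) beta].

Definition Omega (f : {poly int}) : set R[i] :=
  [set w | root (map_poly intr f : {poly R[i]}) w].
Definition Omega_minus (f : {poly int}) : set R[i] :=
  Omega f `&` [set w | `|w| < 1].
Definition Omega_zero (f : {poly int}) : set R[i] :=
  Omega f `&` [set w | `|w| = 1].
Definition Omega_plus (f : {poly int}) : set R[i] :=
  Omega f `&` [set w | 1 < `|w|].

Definition algebraic_unit (x : R) : Prop :=
  integralOver (intr : int -> R) x /\ integralOver (intr : int -> R) x^-1.

(* The conjugates of beta are the complex roots of its minimal polynomial. *)
Definition Salem_number (beta : R) : Prop :=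
  [/\ 1 < beta, algebraic_unit beta &
      exists2 f, is_minpoly beta f &
        (forall w, Omega f w -> w <> real_complex R beta -> `|w| <= 1) /\
        (exists w, Omega_zero f w)].

End SalemNumbers.

Section BoundedSequences.

Definition bounded_seq (K : numDomainType) (w : int -> K) : Prop :=
  exists M : K, forall n, `|w n| <= M.

Definition linfZ : Type := {v : int -> int | bounded_seq v}.

Definition linfZ_fun (v : linfZ) : int -> int := sval v.

Lemma bounded_seq0 : bounded_seq (fun _ : int => 0 : int).
Proof. by exists 0 => n; rewrite normr0. Qed.

HB.instance Definition _ := gen_eqMixin linfZ.
HB.instance Definition _ := gen_choiceMixin linfZ.
HB.instance Definition _ := isPointed.Build linfZ
  (exist _ (fun _ : int => 0 : int) bounded_seq0).

(* shift n is the n-th power of the shift map, n being any integer. *)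
Definition shift (T : Type) (n : int) (w : int -> T) : int -> T :=
  fun k => w (k + n).

Lemma bounded_shift (n : int) (v : linfZ) :
  bounded_seq (shift n (linfZ_fun v)).
Proof. by case: v => v [M vM]; exists M => k; exact: vM. Qed.

Definition shiftZ (n : int) (v : linfZ) : linfZ :=
  exist _ (shift n (linfZ_fun v)) (bounded_shift n v).

(* Since Z is countable and discrete, the coordinate cylinders generate the
   Borel sigma-algebra of the topology of coordinatewise convergence. *)
Definition cylinders : set (set linfZ) :=
  [set A | exists n a : int, A = [set v | linfZ_fun v n = a]].

End BoundedSequences.
Notation mlinfZ := (g_sigma_algebraType cylinders).
Coercion linfZ_fun : linfZ >-> Funclass.

Section BetaShift.
Variables (R : realType) (beta : R).

Definition T_beta (x : R) : R := beta * x - (Num.floor (beta * x))%:~R.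

(* One-sided sequences (x_1, x_2, ...) are functions on nat, the value at k
   being x_(k+1). *)
Definition e_beta (x : R) : {ptws nat -> R} :=
  fun k => beta * iter k T_beta x - iter k.+1 T_beta x.

Definition V_beta_plus : set {ptws nat -> R} :=
  closure [set e_beta x | x in `[0, 1[%classic].

Definition V_beta : set linfZ :=
  [set v | forall n : int,
     V_beta_plus (fun k : nat => (v (n + 1 + k%:Z))%:~R)].

End BetaShift.

Section Homoclinic.
Variables (R : realType) (f : {poly int}).
Local Notation C := R[i].

(* f(shift) w, the shift acting linearly on real sequences. *)
Definition poly_shift (w : int -> R) : int -> R :=
  fun n => \sum_(j < size f) (f`_j)%:~R * shift j%:Z w n.

(* The usual topology of this finite-dimensional space is the subspace
   topology induced by {ptws int -> R}. *)
Definition W_zero : set {ptws int -> R} :=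
  [set w | bounded_seq w /\ forall n, poly_shift w n = 0].

(* The b w, for w a root of f, are determined by this identity between
   rational functions; the other values of b are irrelevant. *)
Definition partial_fraction_coefs (b : C -> C) : Prop :=
  forall u : C, ~ Omega f u ->
    (map_poly intr f : {poly C}).[u]^-1 =
    (lead_coef f)%:~R^-1 * \sum_(w \in @Omega R f) (b w / (u - w)).

Variable b : C -> C.

(* The sums are real because the root sets and b are stable under complex
   conjugation; complex.Re only changes the type. *)
Definition w_Delta_plus : int -> R := fun n => complex.Re (
  if 1 <= n
  then (lead_coef f)%:~R^-1 *
       \sum_(w \in @Omega_minus R f) (b w * w ^ (n - 1))
  else - ((lead_coef f)%:~R^-1 *
       \sum_(w \in @Omega_zero R f `|` @Omega_plus R f) (b w * w ^ (n - 1)))).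

Definition w_Delta_minus : int -> R := fun n => complex.Re (
  if 1 <= n
  then (lead_coef f)%:~R^-1 *
       \sum_(w \in @Omega_minus R f `|` @Omega_zero R f) (b w * w ^ (n - 1))
  else - ((lead_coef f)%:~R^-1 *
       \sum_(w \in @Omega_plus R f) (b w * w ^ (n - 1)))).

(* In the second series the index n < 0 is written - (j + 1). *)
Definition xi_star (v : int -> int) : int -> R := fun k =>
  limn (series (fun n : nat =>
    (v n%:Z)%:~R * shift (- n%:Z) w_Delta_minus k)) +
  limn (series (fun j : nat =>
    (v (- j.+1%:Z))%:~R * shift j.+1%:Z w_Delta_plus k)).

Definition cocycle_d (n : int) (v : linfZ) : {ptws int -> R} := fun k =>
  shift n (xi_star v) k - xi_star (shiftZ n v) k.

Definition shift_invariant (nu : probability mlinfZ R) : Prop :=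
  forall A : set mlinfZ, measurable A -> nu (shiftZ 1 @^-1` A) = nu A.

Definition d_bounded (nu : probability mlinfZ R) : Prop :=
  exists C : set {ptws int -> R}, [/\ compact C, C `<=` W_zero &
    nu [set v | forall k : int, C (cocycle_d k v)] = 1%E].

End Homoclinic.

(* Kolmogorov-Sinai entropy, natural logarithm; ln 0 = 0, so null atoms
   contribute 0. *)
Section Entropy.
Context d (X : measurableType d) (R : realType).
Variables (mu : probability X R) (T : X -> X).

Definition finite_measurable_partition (k : nat) (P : 'I_k -> set X) : Prop :=
  [/\ forall a, measurable (P a), trivIset setT P &
      \bigcup_(a in setT) P a = setT].

(* Entropy of the join of the T^-i P, i < n; its atoms are indexed by the words
   of length n. *)
Definition join_entropy (k : nat) (P : 'I_k -> set X) (n : nat) : R :=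
  \sum_(s : {ffun 'I_n -> 'I_k})
    let p := fine (mu (\bigcap_(i in setT) (iter (nat_of_ord i) T @^-1` P (s i))))
    in - (p * ln p).

Definition partition_entropy (k : nat) (P : 'I_k -> set X) : R :=
  limn (fun n : nat => join_entropy P n / n%:R).

Definition entropy : \bar R :=
  ereal_sup [set h | exists (k : nat) (P : 'I_k -> set X),
    finite_measurable_partition P /\ h = (partition_entropy P)%:E].

End Entropy.

(* Main.v *)
Require Import Defs.
From HB Require Import structures.
From mathcomp Require Import all_boot all_order all_algebra.
From mathcomp Require Import complex.
From mathcomp Require Import all_classical all_reals all_analysis.
From mathcomp Require Import ring lra zify.
Set Implicit Arguments.
Unset Strict Implicit.
Unset Printing Implicit Defensive.
Import Order.TTheory GRing.Theory Num.Theory.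
Import numFieldNormedType.Exports.
Local Open Scope classical_set_scope.
Local Open Scope ring_scope.

(** The cocycle relation shows that d(n, v) is, up to sign and a shift of the
coordinates, the sequence c |-> sum_j v_j delta(c - j), the sum running over an
interval of |n| indices, where delta(c) = Re (sum_w gamma_w w^(c-1)), w running
over the conjugates of modulus one ([cocycleE]). So d(n, v) stays in a fixed
compact set as soon as the exponential sums of v over arbitrary finite windows,
sum_j v_(t+j) w^j, are bounded uniformly in the window, for each of these w
([central_sum_le], [cocycle_event]). The task is to find an invariant measure of
large entropy carried by sequences of the beta-shift all of whose exponential
sums are bounded; call such sequences tame ([tame]).

The exponential sum of a one-sided sequence is a walk in C^L, L being the set of
conjugates of modulus one, whose steps are multiples of the vectors (w^t)_w. Two
facts make it controllable at small cost. First, no w is a root of unity, so the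
vectors (w^k)_w with k < T point in all directions for some fixed T: whatever
the position r of the walk, one of them makes an obtuse angle with r,
quantitatively ([steering]). Inserting one digit 1 at that place pushes the walk
towards the origin. Second, take b' slightly smaller than beta. There are about
b'^N greedy words of length N in base b', their exponential sums lie in a box of
size O(N), and cutting the box into small cells leaves a cell with at least b'^N
/ N^O(1) words, whose sums are all within eta of that of a reference word W_0
([many_close_words]). Concatenate blocks

   pulse of length T, zeros, word W_i, zeros

where i is free and the place of the pulse is chosen from the current position.
After subtracting the periodic walk produced by W_0 alone (which is bounded
because w^P <> 1 for the block length P), each block moves the walk by the pulse
plus an error of size eta, and the pulse wins far from the origin: the squared
distance to the origin stays below a constant ([energy_next], [ev_prefix_le]).
Using b' < beta for the words leaves room for a fixed number of zeros to make
every concatenation admissible in base beta ([full_gword], [full_cat]).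

The free choices i carry the entropy. Choosing them independently and uniformly
among q values, and averaging over time shifts, gives finitely supported laws
that are nearly shift invariant; a word of length n determines about n / P of
the choices, so it has frequency at most about q^(-n/P) ([freq_cylinder_le]). A
limit of these laws is a shift-invariant measure, almost surely all of whose
windows are windows of tame sequences, with the same bound on cylinders
([krylov_bogoliubov], [trajectory_measure]). The bound gives entropy at least
log q / P ([entropy_ge]), and log q >= N log b' - O(log N) with P = N + O(1),
which exceeds P (log beta - eps) for suitable N ([tame_measure]). *)

(* The name is also that of a translation in a normed module. *)
Local Notation shift := Defs.shift.

(** * Finitely additive probabilities and their limits *)

Lemma ptws_sum_continuous (R : realType) (I : choiceType)
    (s : seq (R * I)) :
  continuous (fun f : {ptws I -> R} => \sum_(x <- s) x.1 * f x.2 : R).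
Proof.
pose F (s : seq (R * I)) (f : {ptws I -> R}) : R := \sum_(x <- s) x.1 * f x.2.
rewrite -/(F s); elim: s => [|x s IH].
  have -> : F [::] = cst 0 by apply/funext => g; rewrite /F big_nil.
  exact: cst_continuous.
have E : F (x :: s) = (fun f => x.1 * f x.2) \+ F s.
  by apply/funext => g; rewrite /F big_cons.
have cx : continuous (fun f : {ptws I -> R} => x.1 * f x.2).
  move=> f; have h := @proj_continuous I (fun=> R) x.2 f.
  exact: (@cvgM R {ptws I -> R} (nbhs f) _ (cst x.1) (fun f => f x.2) _ _
    (cvg_cst _) h).
rewrite E => f.
exact: (@cvgD R R {ptws I -> R} (nbhs f) _ _ _ _ _ (cx f) (IH f)).
Qed.

(** A cluster point of the sequence in the compact product of copies of [0, 1]: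
every weak linear inequality in finitely many coordinates that holds eventually
up to an arbitrary error is a closed condition, hence passes to it. *)
Lemma finitely_additive_limit (R : realType) (I : choiceType)
    (pm : nat -> I -> R) : (forall m i, 0 <= pm m i <= 1) ->
  exists p : I -> R, forall (s : seq (R * I)) (b : R),
    (forall e : R, 0 < e ->
      \forall m \near \oo, \sum_(x <- s) x.1 * pm m x.2 <= b + e) ->
    \sum_(x <- s) x.1 * p x.2 <= b.
Proof.
move=> pm01.
pose K := [set f : {ptws I -> R} | forall i, `[0 : R, 1]%classic (f i)].
have cK : compact K.
  exact: (@tychonoff I (fun=> R) (fun=> `[0 : R, 1]%classic)
    (fun=> @segment_compact R 0 1)).
have FK : (nbhs ((pm : nat -> {ptws I -> R}) @ \oo)) K.
  by exists 0%N => // m _ i /=; rewrite in_itv/= pm01.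
have [p [_ pcl]] := cK _ _ FK.
exists p => s b sb; apply/ler_addgt0Pr => e e0.
pose A := [set f : {ptws I -> R} | \sum_(x <- s) x.1 * f x.2 <= b + e].
have cA : closed A.
  apply: (@preimage_closed _ _
    (fun f : {ptws I -> R} => \sum_(x <- s) x.1 * f x.2)
    [set r | r <= b + e]); last exact: closed_le.
  by move=> f _; exact: ptws_sum_continuous.
apply: (cA p) => B Bp; apply: pcl => //.
exact: sb.
Qed.

(** The field M of events is a parameter so that the same lemmas serve a finitely
additive law defined on all subsets and the restriction of a measure to the
measurable sets. *)
Record fin_add_prob (R : realType) (T : Type) (M : set (set T))
    (P : set T -> R) : Prop := FinAddProb {
  fap_setC : forall A, M A -> M (~` A) ;
  fap_setU : forall A B, M A -> M B -> M (A `|` B) ;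
  fap_set0 : M set0 ;
  fap_ge0 : forall A, M A -> 0 <= P A ;
  fap_setT : P setT = 1 ;
  fap_add : forall A B, M A -> M B -> A `&` B = set0 ->
    P (A `|` B) = P A + P B }.

Section FinAddProb.
Variables (R : realType) (T : Type) (M : set (set T)) (P : set T -> R).
Hypothesis MP : fin_add_prob M P.

Lemma fap0 : P set0 = 0.
Proof.
have M0 := fap_set0 MP.
have := fap_add MP M0 M0 (setI0 _); rewrite setU0 => h; lra.
Qed.

Lemma fap_C A : M A -> P (~` A) = 1 - P A.
Proof.
move=> MA; have := fap_add MP MA (fap_setC MP MA) (setICr A).
by rewrite setUCr (fap_setT MP) => h; lra.
Qed.

Lemma fap_setD A B : M A -> M B -> M (A `\` B).
Proof.
move=> MA MB; rewrite (_ : A `\` B = ~` (~` A `|` B)); last first.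
  by rewrite setCU setCK setDE.
exact: (fap_setC MP (fap_setU MP (fap_setC MP MA) MB)).
Qed.

Lemma fap_le A B : M A -> M B -> A `<=` B -> P A <= P B.
Proof.
move=> MA MB AB; have MBA := fap_setD MB MA.
have -> : B = A `|` (B `\` A) by rewrite setDUK.
by rewrite (fap_add MP MA MBA) ?setDIK// lerDl (fap_ge0 MP).
Qed.

Lemma fap_sum_le (I : eqType) (F : I -> set T) (l : seq I) E :
  uniq l -> (forall i, M (F i)) -> M E ->
  {in l &, forall i j, i != j -> F i `&` F j = set0} ->
  {in l, forall i, F i `<=` E} ->
  \sum_(i <- l) P (F i) <= P E.
Proof.
move=> ul MF; elim: l ul E => [|i l IH] /= => [_ E ME _ _|].
  by rewrite big_nil (fap_ge0 MP).
move=> /andP[il ul] E ME Fdisj FE; rewrite big_cons.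
have FiE : F i `<=` E by apply: FE; rewrite mem_head.
have MD := fap_setD ME (MF i).
have -> : E = F i `|` (E `\` F i) by rewrite setDUK.
rewrite (fap_add MP (MF i) MD) ?setDIK// lerD2l; apply: IH => //.
  by move=> j k jl kl; apply: Fdisj; rewrite inE ?jl ?kl orbT.
move=> j jl x Fjx.
split; first by apply: (FE j) => //; rewrite inE jl orbT.
move=> Fix; have ij : i != j by apply: contraNneq il => ->.
have : (F i `&` F j) x by [].
by rewrite Fdisj ?inE ?eqxx ?jl ?orbT.
Qed.

(** The atoms inside E bound P E from below and the others bound P (~` E) from
below; as all atoms have total mass 1, both bounds are equalities. *)
Lemma fap_sum_atoms (I : eqType) (F : I -> set T) (l : seq I) (D : pred I) E :
  uniq l -> (forall i, M (F i)) -> M E ->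
  {in l &, forall i j, i != j -> F i `&` F j = set0} ->
  \sum_(i <- l) P (F i) = 1 ->
  {in l, forall i, D i -> F i `<=` E} ->
  {in l, forall i, ~~ D i -> F i `<=` ~` E} ->
  P E = \sum_(i <- l | D i) P (F i).
Proof.
move=> ul MF ME Fdisj F1 DE NDE.
have Fdisj' C : {in [seq i <- l | C i] &, forall i j, i != j -> F i `&` F j = set0}.
  move=> i j; rewrite !mem_filter => /andP[_ il] /andP[_ jl]; exact: Fdisj.
have h1 : \sum_(i <- l | D i) P (F i) <= P E.
  rewrite -big_filter; apply: fap_sum_le => //; first exact/filter_uniq.
  by move=> i; rewrite mem_filter => /andP[Di il]; exact: DE.
have h2 : \sum_(i <- l | ~~ D i) P (F i) <= P (~` E).
  rewrite -big_filter; apply: fap_sum_le => //; first exact/filter_uniq.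
    exact: (fap_setC MP ME).
  by move=> i; rewrite mem_filter => /andP[Di il]; exact: NDE.
have F2 : \sum_(i <- l | D i) P (F i) + \sum_(i <- l | ~~ D i) P (F i) = 1.
  by rewrite -F1 [RHS](bigID D).
rewrite fap_C// in h2; lra.
Qed.

Lemma fap_setI A B : M A -> M B -> M (A `&` B).
Proof.
move=> MA MB; rewrite -[A `&` B]setCK setCI.
exact: (fap_setC MP (fap_setU MP (fap_setC MP MA) (fap_setC MP MB))).
Qed.

Lemma fap_fiber_sum (B : eqType) (h : T -> B) (E : set T) (l : seq B) :
  uniq l -> M E -> (forall b, M [set t | h t = b]) ->
  P (E `&` [set t | h t \in l]) = \sum_(b <- l) P (E `&` [set t | h t = b]).
Proof.
move=> ul ME Mh; have Ml (l' : seq B) : M [set t | h t \in l'].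
  elim: l' => [|b l' IH].
    by rewrite (_ : [set _ | _] = set0); [exact: fap_set0 MP|apply/seteqP; split].
  rewrite (_ : [set _ | _] = [set t | h t = b] `|` [set t | h t \in l']).
    exact: (fap_setU MP).
  apply/seteqP; split => t /=; rewrite inE; first by case/orP => [/eqP|]; [left|right].
  by case=> [->|->]; rewrite ?eqxx ?orbT.
elim: l ul => [_|b l IH /= /andP[bl ul]].
  rewrite big_nil (_ : _ `&` _ = set0) ?fap0//.
  by apply/seteqP; split => t // -[].
rewrite big_cons -IH// -(fap_add MP); last 3 first.
- exact: fap_setI.
- exact: fap_setI.
- by apply/seteqP; split => t // [[_ /= hb] [_ /=]]; rewrite hb (negbTE bl).
rewrite -setIUr; congr (P (_ `&` _)); apply/seteqP; split => t /=; rewrite inE.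
  by case/orP => [/eqP|]; [left|right].
by case=> [->|->]; rewrite ?eqxx ?orbT.
Qed.

End FinAddProb.

Lemma measure_fin_add_prob d (X : measurableType d) (R : realType)
    (mu : probability X R) :
  fin_add_prob (@measurable d X) (fun A => fine (mu A)).
Proof.
split.
- by move=> A; exact: measurableC.
- by move=> A B; exact: measurableU.
- exact: measurable0.
- by move=> A mA; exact/fine_ge0/measure_ge0.
- by rewrite probability_setT.
- move=> A B mA mB AB; rewrite measureU// fineD//; exact: fin_num_measure.
Qed.

(** * A random sequence with prescribed word probabilities *)

Section Quantile.
Variables (R : realType) (a : nat) (w : seq nat -> R).
Hypothesis w_ge0 : forall s, 0 <= w s.
Hypothesis w_nil : w [::] = 1.
Hypothesis w_rcons : forall s, w s = \sum_(c < a) w (rcons s c).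

(** The interval [0, 1[ is cut into consecutive intervals of lengths w [:: c],
each of these into intervals of lengths w [:: c; c'], and so on; this is the left
end of the interval of s ++ r, measured from that of the interval of s. *)
Fixpoint lo (s : seq nat) (r : seq nat) : R :=
  if r is c :: r' then \sum_(c' < c) w (rcons s c') + lo (rcons s c) r' else 0.

Definition qlo (s : seq nat) : R := lo [::] s.

Lemma lo_rcons s r c :
  lo s (rcons r c) = lo s r + \sum_(c' < c) w (rcons (s ++ r) c').
Proof.
elim: r s => [|x r IH] s /=; first by rewrite cats0 addr0 add0r.
by rewrite IH cat_rcons addrA.
Qed.

Lemma qlo_rcons s c : qlo (rcons s c) = qlo s + \sum_(c' < c) w (rcons s c').
Proof. exact: lo_rcons. Qed.

Definition qint (s : seq nat) : set R := [set x | qlo s <= x < qlo s + w s].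

(** To the right of the interval of s no test succeeds and the value is a. *)
Definition qnext (s : seq nat) (x : R) : nat :=
  find (fun c => x < qlo (rcons s c.+1)) (iota 0 a).

Fixpoint qword (n : nat) (x : R) : seq nat :=
  if n is m.+1 then let s := qword m x in rcons s (qnext s x) else [::].

Lemma size_qword n x : size (qword n x) = n.
Proof. by elim: n => //= n IH; rewrite size_rcons IH. Qed.

Lemma take_qword n m x : (n <= m)%N -> take n (qword m x) = qword n x.
Proof.
elim: m => [|m IH]; first by rewrite leqn0 => /eqP ->.
rewrite leq_eqVlt => /orP[/eqP ->|nm /=].
  by rewrite -{1}(size_qword m.+1 x) take_size.
by rewrite -cats1 takel_cat ?size_qword// IH.
Qed.

Lemma qlo_rconsS s c :
  qlo (rcons s c.+1) = qlo (rcons s c) + w (rcons s c).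
Proof. by rewrite !qlo_rcons big_ord_recr/= addrA. Qed.

Lemma qlo_rcons_homo s c c' :
  (c <= c')%N -> qlo (rcons s c) <= qlo (rcons s c').
Proof.
elim: c' => [|c' IH]; first by rewrite leqn0 => /eqP ->.
rewrite leq_eqVlt => /orP[/eqP ->//|/IH h].
by rewrite qlo_rconsS (le_trans h)// lerDl.
Qed.

Lemma qint_rcons_sub s c : (c < a)%N -> qint (rcons s c) `<=` qint s.
Proof.
move=> ca x /andP[x1 x2]; apply/andP; split.
  apply: le_trans x1; rewrite (le_trans _ (qlo_rcons_homo s (leq0n c)))//.
  by rewrite qlo_rcons big_ord0 addr0.
apply: (lt_le_trans x2); rewrite -qlo_rconsS.
by rewrite (le_trans (qlo_rcons_homo s ca))// qlo_rcons -w_rcons.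
Qed.

Lemma qnextP s x c : x \in qint s -> (c < a)%N ->
  (qnext s x == c) = (x \in qint (rcons s c)).
Proof.
rewrite inE => /andP[x1 x2] ca.
have hhas : has (fun c => x < qlo (rcons s c.+1)) (iota 0 a).
  apply/hasP; exists a.-1; first by rewrite mem_iota; lia.
  by rewrite prednK ?(leq_ltn_trans _ ca)// qlo_rcons -w_rcons.
have fa : (qnext s x < a)%N by move: hhas; rewrite has_find size_iota.
have f1 : x < qlo (rcons s (qnext s x).+1).
  by have := nth_find 0%N hhas; rewrite nth_iota.
have f2 c' : (c' < qnext s x)%N -> qlo (rcons s c'.+1) <= x.
  move=> c'f; have := before_find 0%N c'f.
  rewrite nth_iota//=; last exact: ltn_trans fa.
  by move/negbT; rewrite -leNgt.
apply/eqP/idP => [<-|].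
  rewrite inE /qint/= -qlo_rconsS f1 andbT.
  case e : (qnext s x) => [|m]; first by rewrite qlo_rcons big_ord0 addr0.
  by apply: f2; rewrite e.
rewrite inE /qint/= -qlo_rconsS => /andP[y1 y2].
apply/eqP; rewrite eqn_leq; apply/andP; split; rewrite leqNgt; apply/negP.
  by move/f2 => /(lt_le_trans y2); rewrite ltxx.
by move/(qlo_rcons_homo s) => /(lt_le_trans f1) /lt_le_trans /(_ y1); rewrite ltxx.
Qed.

(** The intervals of the words of length n partition [0, 1[, so a uniform point
x yields a random word in which s appears with probability w s. *)
Lemma qwordP n s x : 0 <= x < 1 -> size s = n ->
  all (fun c => c < a)%N s -> (qword n x == s) = (x \in qint s).
Proof.
move=> x0; elim: n s => [|n IH] s.
  move=> /size0nil -> _ /=; rewrite eqxx; apply/esym.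
  by apply/mem_set; rewrite /qint/= /qlo/= w_nil add0r.
case/lastP: s => [//|s c]; rewrite size_rcons => -[sn].
rewrite all_rcons => /andP[ca sa] /=; rewrite eqseq_rcons IH//.
apply/andP/idP => [[xs /eqP sx]|xsc].
  have E : qword n x = s by apply/eqP; rewrite IH.
  by rewrite -qnextP//; rewrite E in sx; rewrite sx.
have xs : x \in qint s by rewrite inE; apply: (qint_rcons_sub ca); rewrite inE in xsc.
have E : qword n x = s by apply/eqP; rewrite IH.
by split => //; rewrite E qnextP.
Qed.

Lemma qint_sub01 s : all (fun c => c < a)%N s -> qint s `<=` `[0, 1[.
Proof.
elim/last_ind: s => [_ x|s c IH].
  by rewrite /qint/= /qlo/= w_nil add0r in_itv.
rewrite all_rcons => /andP[ca sa].
exact: (subset_trans (qint_rcons_sub ca) (IH sa)).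
Qed.

Lemma lebesgue_qint s : lebesgue_measure (qint s) = (w s)%:E.
Proof.
rewrite /qint (_ : [set _ | _] = `[qlo s, qlo s + w s[%classic); last first.
  by apply/seteqP; split => x /=; rewrite in_itv.
rewrite lebesgue_measure_itv/= lte_fin ltrDl.
case: ifPn => [_|]; first by rewrite -EFinB addrAC subrr add0r.
by rewrite -leNgt => w0; congr EFin; apply/eqP; rewrite eq_le w0 w_ge0.
Qed.

Lemma measurable_qword n s :
  @measurable _ (measurableTypeR R) [set x | qword n x = s].
Proof.
elim: n s => [|n IH] s.
  have [->|s0] := eqVneq s [::].
    by rewrite (_ : [set _ | _] = setT) //; apply/seteqP; split.
  by rewrite (_ : [set _ | _] = set0)//; apply/seteqP; split => x //= /esym/eqP;
    rewrite (negbTE s0).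
case/lastP: s => [|s c].
  rewrite (_ : [set _ | _] = set0)//; apply/seteqP; split => x //= /(congr1 size).
  by rewrite size_rcons.
rewrite (_ : [set _ | _] = [set x | qword n x = s] `&` [set x | qnext s x = c]).
  apply: measurableI => //.
  rewrite /qnext; move: c (iota 0 a) => c l; elim: l c => [|i l IHl] c /=.
    have [->|c0] := eqVneq c 0%N.
      by rewrite (_ : [set _ | _] = setT) //; apply/seteqP; split.
    by rewrite (_ : [set _ | _] = set0)//; apply/seteqP; split => x //= /esym/eqP;
      rewrite (negbTE c0).
  have mi : @measurable _ (measurableTypeR R) [set x | x < qlo (rcons s i.+1)].
    by rewrite -[X in measurable X]set_itvNyo.
  case: c => [|c].
    rewrite (_ : [set _ | _] = [set x | x < qlo (rcons s i.+1)])//.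
    by apply/seteqP; split => x /=; case: ifP.
  rewrite (_ : [set _ | _] = ~` [set x | x < qlo (rcons s i.+1)] `&`
      [set x | find (fun c => x < qlo (rcons s c.+1)) l = c]).
    by apply: measurableI => //; exact: measurableC.
  apply/seteqP; split => x /=; case: ifP => // h.
    by case=> <-; split.
  by case.
  by case=> _ ->.
apply/seteqP; split => x /=.
  by move=> /eqP; rewrite eqseq_rcons => /andP[/eqP <- /eqP].
by case=> -> ->.
Qed.

End Quantile.

(** * Shift-space measures from finitely additive laws *)

(** The bijection 0, -1, 1, -2, 2, ... that turns two-sided sequences into
one-sided ones. *)
Definition zcoord (n : nat) : int := if odd n then Negz n./2 else Posz n./2.
Definition zindex (z : int) : nat :=
  match z with Posz k => k.*2 | Negz k => k.*2.+1 end.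

Lemma zindexK : cancel zindex zcoord.
Proof.
case=> k; rewrite /zcoord /= ?odd_double ?doubleK//.
by rewrite uphalf_double.
Qed.

Lemma zcoordK : cancel zcoord zindex.
Proof.
move=> n; rewrite /zcoord; case: ifPn => on /=; last exact: even_halfK.
by rewrite odd_halfK// prednK// odd_gt0.
Qed.

Lemma zindex_lt (z : int) (n : nat) : `|z| <= n%:Z -> (zindex z < n.*2.+2)%N.
Proof. by case: z => k /=; lia. Qed.

Fixpoint words (a n : nat) : seq (seq nat) :=
  if n is m.+1 then [seq rcons s c | s <- words a m, c <- iota 0 a] else [:: [::]].

Lemma mem_words a n s :
  (s \in words a n) = (size s == n) && all (fun c => c < a)%N s.
Proof.
elim: n s => [|n IH] s /=.
  by rewrite inE; case: s.
apply/allpairsP/andP => [[[t c]] /= []|].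
  rewrite IH mem_iota /= => /andP[/eqP tn ta] ca ->.
  by rewrite size_rcons tn all_rcons ta ca.
case/lastP: s => [|s c]; first by case.
rewrite size_rcons all_rcons eqSS => -[sn /andP[ca sa]].
by exists (s, c); rewrite /= IH sn sa mem_iota.
Qed.

Lemma words_uniq a n : uniq (words a n).
Proof.
elim: n => //= n IH; apply: allpairs_uniq => //; first exact: iota_uniq.
by move=> [s c] [s' c'] _ _ /= /rcons_inj[-> ->].
Qed.

(** A map to a countable set has measurable preimages as soon as its fibres are
measurable. *)
Lemma measurable_countable_pred d (X : measurableType d) (T : countType)
    (h : X -> T) :
  (forall t, measurable [set x | h x = t]) ->
  forall D : set T, measurable [set x | D (h x)].
Proof.
move=> mh D.
rewrite (_ : [set _ | _] = \bigcup_n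
    (if unpickle n is Some t then if `[<D t>] then [set x | h x = t] else set0
     else set0)).
  apply: bigcupT_measurable => n; case: unpickle => [t|//].
  by case: ifPn.
apply/seteqP; split => x /=.
  by move=> Dx; exists (pickle (h x)) => //; rewrite pickleK ifT//; apply/asboolP.
case=> n _; case: unpickle => [t|//]; case: ifPn => [/asboolP Dt|//].
by move=> /= ->.
Qed.

Definition window_determined (n : nat) (E : set (int -> int)) : Prop :=
  forall v v' : int -> int,
    (forall z : int, `|z| <= n%:Z -> v z = v' z) -> E v -> E v'.

Lemma measurable_coord (z k : int) :
  @measurable _ mlinfZ [set v : linfZ | v z = k].
Proof. by apply: sub_sigma_algebra; exists z, k. Qed.

Lemma measurable_window (n : nat) (E : set (int -> int)) :
  window_determined n E -> @measurable _ mlinfZ [set v : linfZ | E v].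
Proof.
move=> En.
pose h (v : mlinfZ) : seq int := [seq (v : linfZ) (zcoord i) | i <- iota 0 n.*2.+2].
have mh t : measurable [set x | h x = t].
  rewrite /h; move: (iota 0 _) => l; elim: l t => [|i l IH] [|k t] /=.
  - by rewrite (_ : [set _ | _] = setT)//; apply/seteqP; split.
  - by rewrite (_ : [set _ | _] = set0)//; apply/seteqP; split.
  - by rewrite (_ : [set _ | _] = set0)//; apply/seteqP; split.
  rewrite (_ : [set _ | _] = [set v : linfZ | v (zcoord i) = k] `&`
    [set x : mlinfZ | [seq (x : linfZ) (zcoord i) | i <- l] = t]).
    by apply: measurableI => //; exact: measurable_coord.
  by apply/seteqP; split => v /= [-> ->].
have := measurable_countable_pred mh
  [set t | E (fun z => nth 0 t (zindex z))].
congr (measurable _); apply/seteqP; split => v /=; apply: En => z /zindex_lt zn;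
  by rewrite /h (nth_map 0%N) ?size_iota// nth_iota//= zindexK.
Qed.

Section SequenceLaw.
Variables (R : realType) (a : nat) (p : set (int -> nat) -> R).
Hypothesis pP : fin_add_prob (fun=> True) p.
Hypothesis pa : p [set y | forall z, (y z < a)%N] = 1.

Let cyl (s : seq nat) : set (int -> nat) :=
  [set y | forall i, (i < size s)%N -> y (zcoord i) = nth 0%N s i].
Let w (s : seq nat) : R := p (cyl s).

Let w_ge0 s : 0 <= w s. Proof. exact: (fap_ge0 pP). Qed.

Let w_nil : w [::] = 1.
Proof.
by rewrite /w (_ : cyl _ = setT) ?(fap_setT pP)//; apply/seteqP; split.
Qed.

Let w_rcons s : w s = \sum_(c < a) w (rcons s c).
Proof.
pose h (y : int -> nat) := y (zcoord (size s)).
have -> : w s = p (cyl s `&` [set y | h y \in iota 0 a]).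
  apply/eqP; rewrite eq_le; apply/andP; split; last first.
    by apply: (fap_le pP) => // y [].
  rewrite /w; set B := _ `&` _.
  rewrite (_ : cyl s = B `|` (cyl s `\` B)); last by rewrite setDUK// => y [].
  rewrite (fap_add pP)// ?setDIK// gerDl.
  have -> : 0 = p (~` [set y | forall z, (y z < a)%N]).
    by rewrite (fap_C pP)// pa subrr.
  apply: (fap_le pP) => // y [sy Ny] ya; apply: Ny; split => //=.
  by rewrite mem_iota /h ya.
rewrite (fap_fiber_sum pP)//; last exact: iota_uniq.
rewrite -[X in iota 0 X]subn0 -/(index_iota 0 a) big_mkord.
apply: eq_bigr => c _; congr p; apply/seteqP; split => y /=.
  move=> [sy yc] i; rewrite size_rcons ltnS nth_rcons.
  by case: ltngtP => // [/sy|->].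
move=> sy; split => [i si|].
  by rewrite sy ?size_rcons ?nth_rcons ?si// ltnW.
by rewrite /= /h sy ?size_rcons// nth_rcons ltnn eqxx.
Qed.

Let sum_words n : \sum_(s <- words a n) w s = 1.
Proof.
elim: n => [|n <-] /=; first by rewrite big_seq1 w_nil.
rewrite big_allpairs_dep; apply: eq_bigr => s _.
by rewrite w_rcons -(big_mkord xpredT (fun c => w (rcons s c))) /index_iota subn0.
Qed.
Let qseq (x : R) : int -> int :=
  fun z => Posz (nth 0%N (qword a w (zindex z).+1 x) (zindex z)).

Let qnext_le s x : (qnext a w s x <= a)%N.
Proof. by rewrite /qnext (leq_trans (find_size _ _))// size_iota. Qed.

Let all_qword n x : all (fun c => c <= a)%N (qword a w n x).
Proof. by elim: n => //= n IH; rewrite all_rcons IH qnext_le. Qed.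

Let qseq_bounded x : bounded_seq (qseq x).
Proof.
exists a%:Z => z; rewrite /qseq ger0_norm// lez_nat.
have /all_nthP := all_qword (zindex z).+1 x; apply.
by rewrite size_qword.
Qed.

Let qlinf (x : measurableTypeR R) : mlinfZ := exist _ (qseq x) (qseq_bounded x).

Let qlinfE x i : (qlinf x : linfZ) (zcoord i) = Posz (nth 0%N (qword a w i.+1 x) i).
Proof. by change (qseq x (zcoord i) = Posz (nth 0%N (qword a w i.+1 x) i));
  rewrite /qseq zcoordK. Qed.

Let measurable_qlinf : measurable_fun setT qlinf.
Proof.
apply: (@measurability _ _ (measurableTypeR R) mlinfZ setT qlinf cylinders) => //.
move=> _ [_ [z [k ->]] <-]; rewrite setTI.
have := @measurable_countable_pred _ (measurableTypeR R) _ (qword a w (zindex z).+1)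
  (measurable_qword a w (zindex z).+1)
  [set s | Posz (nth 0%N s (zindex z)) = k].
by [].
Qed.

HB.instance Definition _ := isMeasurableFun.Build _ _ _ _ qlinf measurable_qlinf.

Let nu : probability mlinfZ R :=
  distribution (uniform_prob (@ltr01 R)) qlinf.

Let cylZ (s : seq nat) : set mlinfZ :=
  [set v : linfZ | forall i, (i < size s)%N -> v (zcoord i) = Posz (nth 0%N s i)].

Let measurable_cylZ s : measurable (cylZ s).
Proof.
apply: (@measurable_window (size s)
  (fun v => forall i, (i < size s)%N -> v (zcoord i) = Posz (nth 0%N s i))).
move=> v v' vv' sv i si; rewrite -vv' ?sv// /zcoord.
by case: ifP => _; lia.
Qed.

Let nu_cylZ n s : s \in words a n -> nu (cylZ s) = (w s)%:E.
Proof.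
rewrite mem_words => /andP[/eqP sn sa].
rewrite /nu /= /distribution /pushforward /uniform_prob integral_uniform_pdf.
set A := _ @^-1` _.
have mA : measurable A.
  by rewrite /A -[X in measurable X]setTI; exact: measurable_qlinf.
transitivity (lebesgue_measure (A `&` `[0, 1]%classic)).
  transitivity (\int[lebesgue_measure]_(x in A `&` `[0%R, 1%R]) 1)%E.
    apply: eq_integral => x; rewrite inE => -[_ /=]; rewrite in_itv/= => x01.
    by rewrite /uniform_pdf x01/= subr0 invr1.
  by rewrite integral_cst ?mul1e//; exact: measurableI.
have AE x : A x <-> qword a w n x = s.
  rewrite /A /cylZ; split => [xs|<- i].
    apply: (@eq_from_nth _ 0%N); rewrite size_qword// => i ilt.
    have := xs i; rewrite sn qlinfE => /(_ ilt)[<-].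
    by rewrite -[LHS](nth_take _ (ltnSn i)) take_qword.
  rewrite size_qword => ilt; by rewrite qlinfE -[in RHS](nth_take _ (ltnSn i)) take_qword.
have mq : measurable (qint w s).
  rewrite /qint (_ : [set _ | _] = `[qlo w s, qlo w s + w s[%classic)//.
rewrite -(lebesgue_qint w_ge0 s) (_ : A `&` _ = qint w s `|` (A `&` [set 1])).
  (* The uniform law lives on the closed interval; its end 1 is negligible. *)
  apply: measureU0 => //; first exact: measurableI.
  apply/eqP; rewrite -measure_le0 -(lebesgue_measure_set1 (1 : R)).
  by apply: le_measure; rewrite ?inE//; exact: measurableI.
apply/seteqP; split => x.
  move=> [Ax /=]; rewrite in_itv/= => /andP[x0].
  rewrite le_eqVlt => /orP[/eqP x1|x1]; first by right.
  left; have : (qword a w n x == s) by apply/eqP/AE.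
  by rewrite (qwordP w_ge0 w_nil w_rcons)// ?x0// inE.
case=> [xs|[Ax x1]]; last first.
  by split => //; rewrite x1/= in_itv/= ler01 lexx.
have := qint_sub01 w_ge0 w_nil w_rcons sa xs; rewrite /= in_itv/= => /andP[x0 x1].
split; last by rewrite /= in_itv/= x0 ltW.
by apply/AE/eqP; rewrite (qwordP w_ge0 w_nil w_rcons) ?x0// inE.
Qed.

Let disj_cyl T (F : seq nat -> set T) n (c : T -> nat -> int) :
  (forall s t, F s t -> forall i, (i < size s)%N -> c t i = Posz (nth 0%N s i)) ->
  {in words a n &, forall s s', s != s' -> F s `&` F s' = set0}.
Proof.
move=> Fc s s'; rewrite !mem_words => /andP[/eqP sn _] /andP[/eqP s'n _] ss'.
apply/seteqP; split => t //= [/Fc ts /Fc ts'].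
move/eqP: ss'; apply; apply: (@eq_from_nth _ 0%N); first by rewrite sn.
by move=> i si; have := ts' i; rewrite s'n -sn => /(_ si); rewrite ts// => -[].
Qed.

(** A finitely additive law p on two-sided sequences with finitely many letters
is realised by a genuine measure: the words read off in the order of [zcoord]
have consistent probabilities, and the image of Lebesgue measure under the
corresponding random sequence has the same finite-dimensional laws.  Compactness
of the sequence space is what makes p countably additive on such events; here the
quantile construction replaces that argument. *)
Lemma sequence_law : exists mu : probability mlinfZ R,
  forall (n : nat) (E : set (int -> int)), window_determined n E ->
    mu [set v : linfZ | E v] = (p [set y | E (fun z => Posz (y z))])%:E.
Proof.
exists nu => n E En; pose N := n.*2.+2.
pose D s := `[< E (fun z => Posz (nth 0%N s (zindex z))) >].
have mE := measurable_window En.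
have EF (s : seq nat) (v : int -> int) : size s = N ->
    (forall i, (i < size s)%N -> v (zcoord i) = Posz (nth 0%N s i)) ->
    E v <-> D s.
  move=> sN vs; have vE z : `|z| <= n%:Z -> v z = Posz (nth 0%N s (zindex z)).
    by move=> /zindex_lt zn; rewrite -{1}(zindexK z) vs// sN.
  split => [Ev|/asboolP]; first by apply/asboolP; apply: En Ev => z /vE.
  by apply: En => z /vE.
have sizew s : s \in words a N -> size s = N by rewrite mem_words => /andP[/eqP].
have nuw s : s \in words a N -> fine (nu (cylZ s)) = w s by move=> /nu_cylZ ->.
transitivity (fine (nu [set v : linfZ | E v]))%:E.
  by rewrite fineK//; exact: fin_num_measure.
congr EFin.
rewrite (fap_sum_atoms (measure_fin_add_prob nu) (F := cylZ) (D := D) (words_uniq a N))//.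
- rewrite (fap_sum_atoms pP (F := cyl) (D := D) (words_uniq a N))//.
  + rewrite big_seq_cond [RHS]big_seq_cond.
    by apply: eq_bigr => s /andP[sw _]; exact: nuw.
  + apply: (disj_cyl (c := fun y i => Posz (y (zcoord i)))) => s y ys i si.
    by rewrite ys.
  + by move=> s /sizew sN Ds y ys /=; apply/(EF s) => // i si; rewrite ys.
  + move=> s /sizew sN Ds y ys /= Ey; move/negP: Ds; apply.
    by apply/(EF s (fun z => Posz (y z)) sN) => // i si; rewrite ys.
- apply: (disj_cyl (c := fun (v : mlinfZ) i => (v : linfZ) (zcoord i))) => s v vs i si.
  exact: vs.
- by rewrite -(sum_words N); apply: eq_big_seq => s /nuw.
- by move=> s /sizew sN Ds v vs /=; apply/(EF s).
- by move=> s /sizew sN Ds v vs /= Ev; move/negP: Ds; apply;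
  apply/(EF s (linfZ_fun v) sN).
Qed.

End SequenceLaw.

(** * Invariant measures from time averages *)

Section Frequency.
Variables (R : realType) (I : finType) (x : I -> int -> nat) (T : nat).
Hypotheses (T_gt0 : (0 < T)%N) (I_gt0 : (0 < #|I|)%N).

Definition freq (E : set (int -> nat)) : R :=
  (\sum_(k < T) \sum_i (`[< E (shift (k : nat)%:Z (x i)) >] : nat)%:R)
  / (T * #|I|)%:R.

Let TI_gt0 : 0 < (T * #|I|)%:R :> R.
Proof. by rewrite ltr0n muln_gt0 T_gt0. Qed.

Lemma freq_ge0 E : 0 <= freq E.
Proof. by rewrite divr_ge0// !sumr_ge0// => i _; rewrite sumr_ge0. Qed.

Lemma freq_full E : (forall (k : nat) i, E (shift k%:Z (x i))) -> freq E = 1.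
Proof.
move=> EE; rewrite /freq.
rewrite (eq_bigr (fun=> #|I|%:R)) => [|k _].
  by rewrite sumr_const card_ord -mulrnA mulnC divff// gt_eqF.
rewrite (eq_bigr (fun=> 1)) ?sumr_const// => i _.
by rewrite asboolT.
Qed.

Lemma freqD E F : E `&` F = set0 -> freq (E `|` F) = freq E + freq F.
Proof.
move=> EF; rewrite /freq -mulrDl -big_split/=; congr (_ / _).
apply: eq_bigr => k _; rewrite -big_split/=; apply: eq_bigr => i _.
set y := shift _ _; rewrite -natrD asbool_or; congr _%:R.
case: asboolP => Ey; case: asboolP => Fy //.
by have : (E `&` F) y by []; rewrite EF.
Qed.

Lemma freq_le1 E : freq E <= 1.
Proof.
have <- : freq setT = 1 by exact: freq_full.
by rewrite -(setUv E) freqD ?setICr// lerDl freq_ge0.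
Qed.

(** The sum over shifts telescopes, so only the two end terms survive. *)
Lemma freq_shift E :
  `|freq [set y | E (shift 1 y)] - freq E| <= T%:R^-1.
Proof.
rewrite /freq -mulrBl -sumrB.
pose u k : R := \sum_i (`[< E (shift k%:Z (x i)) >] : nat)%:R.
rewrite (eq_bigr (fun k : 'I_T => u k.+1 - u k)); last first.
  move=> k _; congr (_ - _); apply: eq_bigr => i _.
  suff -> : shift k.+1%:Z (x i) = shift 1 (shift (k : nat)%:Z (x i)) by [].
  by apply/funext => z; rewrite /shift; congr (x i _); lia.
rewrite -(big_mkord xpredT (fun k => u k.+1 - u k)) telescope_sumr//.
rewrite normrM normfV natrM [`|_ * _|]ger0_norm// invfM mulrCA ler_piMr//.
have uI k : 0 <= u k <= #|I|%:R.
  rewrite /u sumr_ge0//= (le_trans (y := \sum_(i : I) 1))//.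
    by apply: ler_sum => i _; case: asboolP => _ /=; rewrite ?lexx ?ler01.
  by rewrite sumr_const.
rewrite ler_pdivrMr ?ltr0n// mul1r ler_norml.
have := uI T; have := uI 0%N; lra.
Qed.

End Frequency.

Section KrylovBogoliubov.
Variables (R : realType) (a : nat) (Y : set (int -> nat)).
Variables (I : nat -> finType) (x : forall m, I m -> int -> nat) (T : nat -> nat).
Hypotheses (T_gt0 : forall m, (0 < T m)%N) (I_gt0 : forall m, (0 < #|I m|)%N).
Hypothesis T_infty : forall e : R, 0 < e -> \forall m \near \oo, (T m)%:R^-1 <= e.
Hypothesis Y_lt : forall y, Y y -> forall z, (y z < a)%N.
Hypothesis xY : forall m i (k : nat), Y (shift k%:Z (@x m i)).

(** All requirements are linear relations between finitely many frequencies that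
hold up to an error tending to 0, so they survive in the limit given by
[finitely_additive_limit]. *)
Lemma mean_invariant_law : exists p : set (int -> nat) -> R,
  [/\ fin_add_prob (fun=> True) p, p Y = 1,
    forall E, p [set y | E (shift 1 y)] = p E &
    forall E b, (forall e : R, 0 < e -> \forall m \near \oo,
      freq R (@x m) (T m) E <= b + e) -> p E <= b].
Proof.
pose f m E := freq R (@x m) (T m) E.
have f0 m E : 0 <= f m E by exact: freq_ge0.
have f1 m E : f m E <= 1 by exact: freq_le1.
have [p pP] := @finitely_additive_limit R _ f (fun m E => ssrbool.introT andP (conj (f0
  m E) (f1 m E))).
have lim1 E b : (forall e : R, 0 < e -> \forall m \near \oo, f m E <= b + e) -> p E <= b.
  move=> fE; have := pP [:: (1, E)] b; rewrite big_seq1 mul1r; apply => e e0.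
  by near do rewrite big_seq1 mul1r; exact: fE.
have lim1N E b : (forall e : R, 0 < e -> \forall m \near \oo, b - e <= f m E) -> b <= p E.
  move=> fE; have := pP [:: (-1, E)] (- b); rewrite big_seq1 mulN1r lerN2; apply => e e0.
  have := fE e e0; apply: filterS => m h.
  by rewrite big_seq1 mulN1r/=; lra.
have pcst E b : (forall m, f m E = b) -> p E = b.
  move=> fE; apply/eqP; rewrite eq_le; apply/andP; split.
    by apply: lim1 => e e0; near=> m; rewrite fE; lra.
  by apply: lim1N => e e0; near=> m; rewrite fE; lra.
exists p; split => //.
- split => //.
  + by move=> A _; apply: lim1N => e e0; near=> m; have := f0 m A; lra.
  + by apply: pcst => m; apply: freq_full.
  + move=> A B _ _ AB; apply/eqP; rewrite eq_le; apply/andP; split.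
      have := pP [:: (1, A `|` B); (-1, A); (-1, B)] 0.
      rewrite !big_cons big_nil/= !mulN1r mul1r => h.
      suff : p (A `|` B) + (- p A + (- p B + 0)) <= 0 by lra.
      apply: h => e e0; near=> m.
      by rewrite !big_cons big_nil/= !mulN1r mul1r /f freqD//; lra.
    have := pP [:: (-1, A `|` B); (1, A); (1, B)] 0.
    rewrite !big_cons big_nil/= !mulN1r !mul1r => h.
    suff : - p (A `|` B) + (p A + (p B + 0)) <= 0 by lra.
    apply: h => e e0; near=> m.
    by rewrite !big_cons big_nil/= !mulN1r !mul1r /f freqD//; lra.
- by apply: pcst => m; apply: freq_full.
- move=> E; set E' := [set y | _].
  have fE m := @freq_shift R _ (@x m) _ (T_gt0 m) (I_gt0 m) E.
  apply/eqP; rewrite eq_le; apply/andP; split.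
    have := pP [:: (1, E'); (-1, E)] 0.
    rewrite !big_cons big_nil/= !mulN1r mul1r => h.
    suff : p E' + (- p E + 0) <= 0 by lra.
    apply: h => e e0; have := T_infty e0; apply: filterS => m Te.
    rewrite !big_cons big_nil/= !mulN1r mul1r.
    by have := fE m; rewrite -/E' -/(f m E') -/(f m E) ler_norml; lra.
  have := pP [:: (-1, E'); (1, E)] 0.
  rewrite !big_cons big_nil/= !mulN1r mul1r => h.
  suff : - p E' + (p E + 0) <= 0 by lra.
  apply: h => e e0; have := T_infty e0; apply: filterS => m Te.
  rewrite !big_cons big_nil/= !mulN1r mul1r.
  by have := fE m; rewrite -/E' -/(f m E') -/(f m E) ler_norml; lra.
Unshelve. all: by end_near. Qed.

Lemma window_determinedI n n' E E' : window_determined n E ->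
  window_determined n' E' -> window_determined (maxn n n') (E `&` E').
Proof.
move=> nE nE' v v' vv' [Ev Ev']; split.
  by apply: nE Ev => z zn; apply: vv'; lia.
by apply: nE' Ev' => z zn; apply: vv'; lia.
Qed.

Lemma window_determined_shift n E : window_determined n E ->
  window_determined n.+1 [set v | E (shift 1 v)].
Proof.
by move=> nE v v' vv'; apply: nE => z zn; apply: vv'; lia.
Qed.

Lemma measurable_shiftZ : measurable_fun setT (shiftZ 1 : mlinfZ -> mlinfZ).
Proof.
apply: (@measurability _ _ mlinfZ mlinfZ setT _ cylinders) => //.
move=> _ [_ [z [k ->]] <-]; rewrite setTI.
exact: (measurable_coord (z + 1) k).
Qed.

(** Besides invariance, the limit measure gives full mass to every event of
finitely many coordinates that all sampled sequences satisfy, and inherits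
asymptotic upper bounds on frequencies.  Such bounds on cylinders replace the
upper semicontinuity of entropy. *)
Lemma krylov_bogoliubov : exists mu : probability mlinfZ R,
  [/\ shift_invariant mu,
    forall n E, window_determined n E -> (forall y, Y y -> E (fun z => Posz (y z))) ->
      mu [set v : linfZ | E v] = 1%E &
    forall n E (b : R), window_determined n E ->
      (forall e : R, 0 < e -> \forall m \near \oo,
        freq R (@x m) (T m) [set y | E (fun z => Posz (y z))] <= b + e) ->
      fine (mu [set v : linfZ | E v]) <= b].
Proof.
have [p [pP pY pshift pb]] := mean_invariant_law.
have pmono E : Y `<=` E -> p E = 1.
  move=> YE; apply/eqP; rewrite eq_le; apply/andP; split.
    by rewrite -(fap_setT pP); apply: (fap_le pP).
  by rewrite -pY; apply: (fap_le pP).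
have [mu muE] := sequence_law pP (pmono _ Y_lt).
exists mu; split.
- pose G : set (set mlinfZ) := [set A | exists n E, window_determined n E /\
    A = [set v : linfZ | E v]].
  have GT : G setT by exists 0%N, setT.
  pose S : {mfun mlinfZ >-> mlinfZ} := mfun_Sub (mem_set measurable_shiftZ).
  move=> A mA; apply: (measure_unique G (fun=> setT) _ _ _ _ (distribution mu S) mu) =>
    //.
  + apply/seteqP; split.
      apply: sub_sigma_algebra2 => _ [z [k ->]]; exists `|z|%N, [set v | v z = k].
      by split => // v v' vv' /= <-; apply/esym/vv'; lia.
    apply: smallest_sub; first exact: sigma_algebra_measurable.
    by move=> _ [n [E [nE ->]]]; exact: measurable_window nE.
  + move=> _ _ [n [E [nE ->]]] [n' [E' [nE' ->]]].
    exists (maxn n n'), (E `&` E'); split => //; exact: window_determinedI.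
  + by rewrite bigcup_const.
  + move=> _ [n [E [nE ->]]].
    have h1 := muE _ _ nE; rewrite -pshift in h1.
    have h2 := muE _ _ (window_determined_shift nE).
    exact: (etrans h2 (esym h1)).
  + move=> _; exact: (le_lt_trans (probability_le1 (distribution mu S) measurableT)
    (ltry 1)).
- by move=> n E nE YE; rewrite (muE _ _ nE) pmono.
- by move=> n E b nE fE; rewrite (muE _ _ nE)/=; exact: pb.
Qed.

End KrylovBogoliubov.

(** * Kolmogorov-Sinai entropy from decay of cylinders *)

(** Writing n = q N + r gives u n / n <= u N / N + O(1 / n), so the limit is the
infimum of the u N / N. *)
Lemma fekete (R : realType) (u : nat -> R) :
  (forall n, 0 <= u n) -> (forall n m, u (n + m)%N <= u n + u m) ->
  cvgn (fun n => u n / n%:R).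
Proof.
move=> u0 uD.
pose A := [set u n.+1 / n.+1%:R | n in setT].
have Anneg : lbound A 0 by move=> _ [n _ <-]; rewrite divr_ge0.
have hA : has_inf A by split; [exists (u 1%N / 1), 0%N | exists 0].
pose l := inf A.
have l_le n : (0 < n)%N -> l <= u n / n%:R.
  by case: n => // n _; apply: ge_inf; [exists 0 | exists n].
apply: (cvgP l); apply/cvgrPdist_le => e e0.
have e20 : 0 < e / 2 by rewrite divr_gt0.
have [_ [N _ <-] uN] := inf_adherent e20 hA.
pose M := \sum_(r < N.+1) u r.
have uM r : (r < N.+1)%N -> u r <= M.
  move=> rN; rewrite /M (bigD1 (Ordinal rN))//= lerDl.
  by apply: sumr_ge0 => i _; exact: u0.
have uq q r : u (q * N.+1 + r)%N <= q%:R * u N.+1 + u r.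
  elim: q => [|q IH]; first by rewrite mul0n add0n mul0r add0r.
  rewrite mulSn -addnA (le_trans (uD _ _))// -natr1 mulrDl mul1r.
  lra.
near=> n.
have n0 : (0 < n)%N by near: n; exact: nbhs_infty_gt.
have nR : 0 < n%:R :> R by rewrite ltr0n.
have Mn : M / (e / 2) <= n%:R by near: n; exact: nbhs_infty_ger.
have l1 := l_le n n0.
rewrite distrC ger0_norm ?subr_ge0// lerBlDr.
rewrite ler_pdivrMr// in Mn.
suff h : u n / n%:R <= u N.+1 / N.+1%:R + e / 2.
  have uN' : u N.+1 / N.+1%:R < l + e / 2 by exact: uN.
  set t := u N.+1 / _ in h uN'; lra.
rewrite ler_pdivrMr// mulrDl.
have un : u n <= (n %/ N.+1)%:R * u N.+1 + M.
  rewrite [in leLHS](divn_eq n N.+1); apply: (le_trans (uq _ _)).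
  by rewrite lerD2l; apply: uM; rewrite ltn_mod.
apply: (le_trans un); apply: lerD; last by rewrite mulrC.
rewrite mulrAC ler_pdivlMr ?ltr0n// mulrAC -natrM [leRHS]mulrC ler_wpM2r//.
by rewrite ler_nat leq_trunc_div.
Unshelve. all: by end_near. Qed.

Section FiniteEntropy.
Variable R : realType.

Definition shannon (A : finType) (q : A -> R) : R := \sum_a - (q a * ln (q a)).

Lemma shannon_ge0 (A : finType) (q : A -> R) :
  (forall a, 0 <= q a <= 1) -> 0 <= shannon q.
Proof.
move=> q01; apply: sumr_ge0 => a _; have /andP[q0 q1] := q01 a.
by rewrite oppr_ge0 mulr_ge0_le0// ln_le0.
Qed.

(** The inequality ln t <= t - 1 at t = y / x. *)
Lemma gibbs_term (x y : R) : 0 <= x -> 0 <= y -> (y = 0 -> x = 0) ->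
  x * ln y - x * ln x <= y - x.
Proof.
move=> x0 y0 yx; have [->|xn0] := eqVneq x 0.
  by rewrite !mul0r !subr0.
have xp : 0 < x by rewrite lt_neqAle eq_sym xn0.
have yp : 0 < y.
  by rewrite lt_neqAle y0 andbT eq_sym; apply: contraNneq xn0 => /yx ->.
have := @le_ln1Dx R (y / x - 1).
rewrite (_ : 1 + (y / x - 1) = y / x); last by ring.
rewrite lnM ?posrE ?invr_gt0// lnV ?posrE// => h.
rewrite -mulrBr -(ler_pM2l (x := x^-1)) ?invr_gt0// mulKf// mulrBr mulVf//.
rewrite mulrC; apply: h.
by rewrite ltrBDr addNr divr_gt0.
Qed.

(** Gibbs' inequality between q and the product of its marginals. *)
Lemma shannon_subadditive (A B : finType) (q : A * B -> R) :
  (forall c, 0 <= q c) -> \sum_c q c = 1 ->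
  shannon q <= shannon (fun a => \sum_b q (a, b))
             + shannon (fun b => \sum_a q (a, b)).
Proof.
move=> q0 q1; set qa := fun a => _; set qb := fun b => _.
have qa0 a : 0 <= qa a by apply: sumr_ge0.
have qb0 b : 0 <= qb b by apply: sumr_ge0.
have qqa a b : qa a = 0 -> q (a, b) = 0.
  by move/eqP; rewrite psumr_eq0// => /allP/(_ b);
    rewrite mem_index_enum => /(_ erefl)/eqP.
have qqb a b : qb b = 0 -> q (a, b) = 0.
  by move/eqP; rewrite psumr_eq0// => /allP/(_ a);
    rewrite mem_index_enum => /(_ erefl)/eqP.
have sa : \sum_a qa a = 1 by rewrite -q1 pair_big/=; apply: eq_bigr => -[].
have sb : \sum_b qb b = 1.
  by rewrite -sa exchange_big/=.
have Ea : shannon qa = \sum_c - (q c * ln (qa c.1)).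
  transitivity (\sum_a \sum_b - (q (a, b) * ln (qa a))).
    by apply: eq_bigr => a _; rewrite sumrN mulr_suml.
  by rewrite pair_bigA; apply: eq_bigr => -[].
have Eb : shannon qb = \sum_c - (q c * ln (qb c.2)).
  transitivity (\sum_b \sum_a - (q (a, b) * ln (qb b))).
    by apply: eq_bigr => b _; rewrite sumrN mulr_suml.
  by rewrite exchange_big pair_bigA; apply: eq_bigr => -[].
rewrite Ea Eb -subr_ge0 -!sumrN -!big_split/=.
rewrite (le_trans (y := \sum_c (q c - qa c.1 * qb c.2)))//.
  rewrite sumrB q1 -(pair_bigA _ (fun a b => qa a * qb b))/= subr_ge0.
  by under eq_bigr do rewrite -mulr_sumr sb mulr1; rewrite sa.
apply: ler_sum => -[a b] _ /=.
have := @gibbs_term (q (a, b)) (qa a * qb b) (q0 _) (mulr_ge0 (qa0 a) (qb0 b)).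
have [->|qn0] := eqVneq (q (a, b)) 0.
  by move=> _; rewrite !mul0r !oppr0 !addr0 sub0r oppr_le0 mulr_ge0.
have ap : 0 < qa a by rewrite lt_neqAle qa0 andbT eq_sym;
  apply: contraNneq qn0 => /qqa ->.
have bp : 0 < qb b by rewrite lt_neqAle qb0 andbT eq_sym;
  apply: contraNneq qn0 => /qqb ->.
rewrite lnM ?posrE// => h.
have : qa a * qb b = 0 -> q (a, b) = 0.
  by move/eqP; rewrite mulf_eq0 !gt_eqF.
by move/h; lra.
Qed.

End FiniteEntropy.

Section EntropyBound.
Context d (X : measurableType d) (R : realType).
Variables (mu : probability X R) (T : X -> X) (k : nat) (c : X -> 'I_k).
Hypothesis mT : measurable_fun setT T.
Hypothesis muT : forall A, measurable A -> mu (T @^-1` A) = mu A.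
Hypothesis mc : forall a, measurable [set x | c x = a].

Let P A : R := fine (mu A).
Let PM := measure_fin_add_prob mu.

(** Its fibres are the atoms of the join of the T^-i of that partition. *)
Definition itinerary n (x : X) : {ffun 'I_n -> 'I_k} :=
  [ffun i : 'I_n => c (iter i T x)].

Let measurable_iter n A : measurable A -> measurable (iter n T @^-1` A).
Proof.
elim: n A => [//|n IH] A mA.
rewrite (_ : _ @^-1` A = iter n T @^-1` (T @^-1` A))//; apply: IH.
by rewrite -[X in measurable X]setTI; exact: mT.
Qed.

Let mu_iter n A : measurable A -> mu (iter n T @^-1` A) = mu A.
Proof.
elim: n A => [//|n IH] A mA.
rewrite (_ : _ @^-1` A = iter n T @^-1` (T @^-1` A))// IH ?muT//.
by rewrite -[X in measurable X]setTI; exact: mT.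
Qed.

Let join_atom n (s : {ffun 'I_n -> 'I_k}) :
  \bigcap_(i in [set: 'I_n]) (iter i T @^-1` [set x | c x = s i]) =
  [set x | itinerary n x = s].
Proof.
apply/seteqP; split => x /= xs.
  by apply/ffunP => i; rewrite ffunE; exact: xs.
by move=> i _ /=; rewrite -xs ffunE.
Qed.

Let measurable_itinerary n (s : {ffun 'I_n -> 'I_k}) :
  measurable [set x | itinerary n x = s].
Proof.
rewrite -join_atom; apply: fin_bigcap_measurable => // i _.
exact: measurable_iter.
Qed.

Let PE (B : finType) (h : X -> B) E : (forall b, measurable [set x | h x = b]) ->
  measurable E -> P E = \sum_b P (E `&` [set x | h x = b]).
Proof.
move=> mh mE; rewrite -(fap_fiber_sum PM)//; last exact: index_enum_uniq.
rewrite /P; congr (fine (mu _)); apply/seteqP; split => [x Ex|x []//].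
by split => //=; rewrite mem_index_enum.
Qed.

Let q n (s : {ffun 'I_n -> 'I_k}) : R := P [set x | itinerary n x = s].

Let join_entropyE n :
  join_entropy mu T (fun a => [set x | c x = a]) n = shannon (@q n).
Proof. by apply: eq_bigr => s _; rewrite /= /q join_atom. Qed.

Let q_ge0 n s : 0 <= @q n s.
Proof. exact/fine_ge0. Qed.

Let q_sum n : \sum_s @q n s = 1.
Proof.
have <- : P setT = 1 by rewrite /P probability_setT.
rewrite (PE (@measurable_itinerary n) measurableT).
by apply: eq_bigr => s _; rewrite setTI.
Qed.

Let q_le1 n s : @q n s <= 1.
Proof. by rewrite -(q_sum n) (bigD1 s)//= lerDl sumr_ge0. Qed.

Let ffun_cat n m (s : {ffun 'I_n -> 'I_k} * {ffun 'I_m -> 'I_k}) :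
    {ffun 'I_(n + m) -> 'I_k} :=
  [ffun i => match fintype.split i with inl j => s.1 j | inr j => s.2 j end].

Let ffun_cat_bij n m : bijective (@ffun_cat n m).
Proof.
exists (fun s : {ffun 'I_(n + m) -> 'I_k} =>
  ([ffun i => s (lshift m i)], [ffun i => s (rshift n i)])).
  move=> [s t]; congr pair; apply/ffunP => i; rewrite !ffunE.
    by rewrite -[lshift m i]/(unsplit (inl i)) unsplitK.
  by rewrite -[rshift n i]/(unsplit (inr i)) unsplitK.
move=> s; apply/ffunP => i; rewrite ffunE /=.
by rewrite -{2}(splitK i); case: fintype.split => j; rewrite ffunE.
Qed.

Let itinerary_cat n m x :
  itinerary (n + m) x = ffun_cat (itinerary n x, itinerary m (iter n T x)).
Proof.
apply/ffunP => i; rewrite !ffunE/=.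
rewrite -{1}(splitK i); case: fintype.split => j; rewrite ffunE//=.
by rewrite addnC iterD.
Qed.

Let shannon_itinerary_subadditive n m :
  shannon (@q (n + m)) <= shannon (@q n) + shannon (@q m).
Proof.
pose qq (s : {ffun 'I_n -> 'I_k} * {ffun 'I_m -> 'I_k}) := @q (n + m) (ffun_cat s).
have -> : shannon (@q (n + m)) = shannon qq.
  by rewrite /shannon (reindex (@ffun_cat n m))//; exact: onW_bij (ffun_cat_bij n m).
have qqE s t : qq (s, t) = P ([set x | itinerary n x = s] `&`
    iter n T @^-1` [set x | itinerary m x = t]).
  rewrite /qq /q; congr P; apply/seteqP; split => x /=; rewrite itinerary_cat.
    by move/(bij_inj (ffun_cat_bij n m)) => [-> ->].
  by case=> -> ->.
have -> : @q n = (fun s => \sum_t qq (s, t)).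
  apply/funext => s; rewrite /q (PE (h := fun x => itinerary m (iter n T x)))//.
    by apply: eq_bigr => t _; rewrite qqE.
  by move=> t; exact: (measurable_iter n (measurable_itinerary t)).
have -> : @q m = (fun t => \sum_s qq (s, t)).
  apply/funext => t; rewrite /q {1}/P -(mu_iter n (measurable_itinerary t)) -/(P _).
  rewrite (PE (@measurable_itinerary n)); last exact: measurable_iter.
  by apply: eq_bigr => s _; rewrite qqE setIC.
apply: shannon_subadditive => [s|]; first exact: q_ge0.
rewrite -(q_sum (n + m)) [RHS](reindex (@ffun_cat n m))//.
exact: onW_bij (ffun_cat_bij n m).
Qed.

(** The entropy of the n-th join is at least n h - C, because - ln of the mass of
each atom is.  Subadditivity, from invariance of mu, makes the entropy per letter
converge, so the bound reaches the limit. *)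
Lemma entropy_ge (h C : R) :
  (forall n (s : 'I_n -> 'I_k),
    fine (mu [set x | forall i : 'I_n, c (iter i T x) = s i]) <= expR (C - n%:R * h)) ->
  (h%:E <= entropy mu T)%E.
Proof.
move=> hC; pose Q (a : 'I_k) := [set x | c x = a].
have Qpart : finite_measurable_partition Q.
  split => //.
    by move=> a b _ _ [x [/= <- <-]].
  by apply/seteqP; split => // x _; exists (c x).
have cvgH : cvgn (fun n => join_entropy mu T Q n / n%:R).
  under eq_fun do rewrite join_entropyE.
  apply: (@fekete R (fun n => shannon (@q n))) => [n|n m].
    by apply: shannon_ge0 => s; rewrite q_ge0 q_le1.
  exact: shannon_itinerary_subadditive.
have Hge n : n%:R * h - C <= join_entropy mu T Q n.
  rewrite join_entropyE -[leLHS]mul1r -{1}(q_sum n) mulr_suml; apply: ler_sum => s _.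
  have [->|qn0] := eqVneq (@q n s) 0; first by rewrite !mul0r oppr0.
  have qp : 0 < @q n s by rewrite lt_neqAle q_ge0 andbT eq_sym.
  rewrite -mulrN ler_pM2l// lerNr.
  have : @q n s <= expR (C - n%:R * h).
    apply: le_trans (hC n s); rewrite le_eqVlt; apply/orP; left; apply/eqP.
    rewrite /q /P; congr (fine (mu _)); apply/seteqP; split => x /= xs.
      by move=> i; rewrite -xs ffunE.
    by apply/ffunP => i; rewrite ffunE.
  move=> qe; by rewrite opprB -[leRHS]expRK ler_ln ?posrE ?expR_gt0.
apply: (le_trans (y := (partition_entropy mu T Q)%:E)); last first.
  by apply: ereal_sup_ubound; exists k, Q.
rewrite lee_fin /partition_entropy.
apply/ler_addgt0Pr => e e0; rewrite -lerBlDr.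
apply: limr_ge => //; near=> n.
have n0 : (0 < n)%N by near: n; exact: nbhs_infty_gt.
have nC : C / e <= n%:R by near: n; exact: nbhs_infty_ger.
rewrite ler_pdivlMr ?ltr0n//; apply: le_trans (Hge n).
rewrite ler_pdivrMr// in nC; rewrite mulrBl; lra.
Unshelve. all: by end_near. Qed.

End EntropyBound.

(** * Steering a bounded walk with powers of unimodular numbers *)

Section ComplexModulus.
Variable R : realType.
Local Notation C := R[i].
Implicit Types z w : C.

(** The modulus as a real number rather than as a complex one, so that the
decision procedures for ordered fields apply. *)
Definition nrm z : R := complex.Re `|z|.

Lemma nrmE z : `|z| = (nrm z)%:C%C.
Proof. by rewrite /nrm normc_def. Qed.

Lemma nrm_ge0 z : 0 <= nrm z.
Proof. by rewrite -lecR -nrmE normr_ge0. Qed.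

Lemma nrmM z w : nrm (z * w) = nrm z * nrm w.
Proof. by apply: complexI; rewrite rmorphM/= -!nrmE normrM. Qed.

Lemma nrmD z w : nrm (z + w) <= nrm z + nrm w.
Proof. by rewrite -lecR rmorphD/= -!nrmE ler_normD. Qed.

Lemma nrmN z : nrm (- z) = nrm z.
Proof. by rewrite /nrm normrN. Qed.

Lemma nrmX z n : nrm (z ^+ n) = nrm z ^+ n.
Proof. by apply: complexI; rewrite rmorphXn/= -!nrmE normrX. Qed.

Lemma nrmV z : nrm z^-1 = (nrm z)^-1.
Proof. by apply: complexI; rewrite fmorphV/= -!nrmE normfV. Qed.

Lemma nrm1 : nrm 1 = 1.
Proof. by rewrite /nrm normr1. Qed.

Lemma nrm0 : nrm 0 = 0.
Proof. by rewrite /nrm normr0. Qed.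

Lemma nrm_eq0 z : (nrm z == 0) = (z == 0).
Proof. by rewrite -(inj_eq (@complexI R)) -nrmE normr_eq0. Qed.

Lemma nrm_gt0 z : z != 0 -> 0 < nrm z.
Proof. by move=> z0; rewrite lt_neqAle nrm_ge0 andbT eq_sym nrm_eq0. Qed.

Lemma nrmJ z : nrm z^*%C = nrm z.
Proof. by rewrite /nrm normcJ. Qed.

Lemma nrm_real (x : R) : nrm x%:C%C = `|x|.
Proof. by apply: complexI; rewrite -nrmE normc_def /= expr0n addr0 sqrtr_sqr. Qed.

Lemma normc_nrm z (x : R) : (`|z| == x%:C%C) = (nrm z == x).
Proof. by rewrite nrmE (inj_eq (@complexI R)). Qed.

Lemma nrm_sum (I : Type) (l : seq I) (F : I -> C) :
  nrm (\sum_(i <- l) F i) <= \sum_(i <- l) nrm (F i).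
Proof.
elim: l => [|i l IH]; first by rewrite !big_nil nrm0.
by rewrite !big_cons (le_trans (nrmD _ _))// lerD2l.
Qed.

Lemma ReD z w : complex.Re (z + w) = complex.Re z + complex.Re w.
Proof. by case: z; case: w. Qed.

Lemma ReN z : complex.Re (- z) = - complex.Re z.
Proof. by case: z. Qed.

Lemma Re_sum (I : Type) (l : seq I) (P : pred I) (F : I -> C) :
  complex.Re (\sum_(i <- l | P i) F i) = \sum_(i <- l | P i) complex.Re (F i).
Proof.
elim: l => [|i l IH]; first by rewrite !big_nil.
by rewrite !big_cons; case: ifP; rewrite ?ReD IH.
Qed.

Lemma ReZ (x : R) z : complex.Re (x%:C%C * z) = x * complex.Re z.
Proof. by case: z => a b /=; rewrite mul0r subr0. Qed.

Lemma Re_le_nrm z : `|complex.Re z| <= nrm z.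
Proof. by rewrite -lecR -nrmE normc_ge_Re. Qed.

Lemma nrm_sqr z : (nrm z ^+ 2)%:C%C = z * z^*%C.
Proof. by rewrite rmorphXn/= -nrmE sqr_normc. Qed.

Lemma nrm_sqrD z w :
  nrm (z + w) ^+ 2 = nrm z ^+ 2 + 2 * complex.Re (z^*%C * w) + nrm w ^+ 2.
Proof.
apply: complexI; rewrite !rmorphD/= !nrm_sqr rmorphD/=.
have -> : (2 * complex.Re (z^*%C * w))%:C%C = z^*%C * w + z * w^*%C.
  by rewrite rmorphM/= rmorph_nat -addcJ rmorphM/= conjcK.
by ring.
Qed.

Lemma nrm1_inv z : nrm z = 1 -> z^-1 = z^*%C.
Proof. by move=> z1; rewrite invc_norm nrmE z1 expr1n invr1 mul1r. Qed.

Lemma nrm_geometric z n : nrm z = 1 -> z != 1 ->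
  nrm (\sum_(k < n) z ^+ k) <= 2 / nrm (1 - z).
Proof.
move=> z1 zn1; rewrite ler_pdivlMr; last by rewrite nrm_gt0// subr_eq0 eq_sym.
rewrite -nrmM mulrC -opprB mulNr -subrX1 nrmN (le_trans (nrmD _ _))//.
by rewrite nrmN nrmX z1 expr1n nrm1.
Qed.

End ComplexModulus.

Section Steering.
Variables (R : realType) (L : seq R[i]).
Hypothesis uL : uniq L.
Hypothesis L1 : {in L, forall l, nrm l = 1}.
Hypothesis LJ : {in L, forall l, (l^*%C) \in L}.
Hypothesis Ln1 : 1 \notin L.

(** Exponential sums of real sequences have this property; it makes
sum_l (p l)^* l^k real, since L is stable under conjugation. *)
Definition self_conj (p : R[i] -> R[i]) := forall l, p l^*%C = (p l)^*%C.

Definition norm1 (p : R[i] -> R[i]) : R := \sum_(l <- L) nrm (p l).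

Let z (p : R[i] -> R[i]) (k : nat) : R[i] := \sum_(l <- L) (p l)^*%C * l ^+ k.

Let LJ_perm : perm_eq [seq l^*%C | l <- L] L.
Proof.
apply: uniq_perm => //; first by rewrite map_inj_uniq//; exact: (can_inj (@conjcK R)).
move=> l; apply/mapP/idP => [[m mL ->]|lL]; first exact: LJ.
by exists l^*%C; rewrite ?LJ// conjcK.
Qed.

Let z_conj p k : self_conj p -> (z p k)^*%C = z p k.
Proof.
move=> pJ; rewrite {2}/z -(perm_big _ LJ_perm)/= big_map rmorph_sum/=.
by apply: eq_bigr => l _; rewrite rmorphM rmorphXn/= pJ.
Qed.

Let norm1_ge0 p : 0 <= norm1 p.
Proof. by apply: sumr_ge0 => l _; exact: nrm_ge0. Qed.

Let a p k : R := complex.Re (z p k).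

Let a_le p k : `|a p k| <= norm1 p.
Proof.
apply: (le_trans (Re_le_nrm _)); apply: (le_trans (nrm_sum _ _)).
rewrite /norm1 big_seq [leRHS]big_seq; apply: ler_sum => l lL.
by rewrite nrmM nrmJ nrmX (L1 lL) expr1n mulr1.
Qed.

Let nrm_le_norm1 p l : l \in L -> nrm (p l) <= norm1 p.
Proof.
move=> lL; rewrite /norm1 (bigD1_seq l)//= lerDl.
by apply: sumr_ge0 => m _; exact: nrm_ge0.
Qed.

Let K1 : R := \sum_(l <- L) 2 / nrm (1 - l).
Let K2 : R := \sum_(l <- L) \sum_(m <- L | m != l) 2 / nrm (1 - l * m^*%C).

Let mean_a p T : \sum_(k < T) a p k <= K1 * norm1 p.
Proof.
rewrite /a -Re_sum; apply: (le_trans (ler_norm _)).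
apply: (le_trans (Re_le_nrm _)); rewrite /z exchange_big/=.
apply: (le_trans (nrm_sum _ _)); rewrite mulr_suml big_seq [leRHS]big_seq.
apply: ler_sum => l lL; rewrite -mulr_sumr nrmM nrmJ mulrC.
apply: ler_pM; rewrite ?nrm_ge0 ?nrm_le_norm1//.
by apply: nrm_geometric; [exact: L1|apply: contraNneq Ln1 => <-].
Qed.

(** The diagonal terms give T sum_l |p l|^2; off the diagonal the sum over k is
geometric with ratio l m^* <> 1. *)
Let square_a p T : self_conj p ->
  T%:R * (\sum_(l <- L) nrm (p l) ^+ 2) - K2 * norm1 p ^+ 2 <= \sum_(k < T) a p k ^+ 2.
Proof.
move=> pJ.
have aE k : a p k ^+ 2 = complex.Re (z p k * (z p k)^*%C).
  have zE : z p k = (a p k)%:C%C.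
    by rewrite /a RRe_real// CrealE; apply/eqP; exact: z_conj.
  by rewrite -nrm_sqr zE nrm_real real_normK ?num_real.
rewrite (eq_bigr _ (fun (k : 'I_T) _ => aE k)) -Re_sum.
have -> : \sum_(k < T) z p k * (z p k)^*%C =
    \sum_(l <- L) \sum_(m <- L) (p l)^*%C * p m * \sum_(k < T) (l * m^*%C) ^+ k.
  have zz k : z p k * (z p k)^*%C =
      \sum_(l <- L) \sum_(m <- L) (p l)^*%C * p m * (l * m^*%C) ^+ k.
    rewrite {1}/z mulr_suml; apply: eq_bigr => l _.
    rewrite /z rmorph_sum/= mulr_sumr; apply: eq_bigr => m _.
    by rewrite rmorphM rmorphXn/= conjcK mulrACA -exprMn.
  rewrite (eq_bigr _ (fun (k : 'I_T) _ => zz k)).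
  rewrite exchange_big/=; apply: eq_bigr => l _.
  by rewrite exchange_big/=; apply: eq_bigr => m _; rewrite mulr_sumr.
rewrite Re_sum mulr_sumr /K2 mulr_suml -sumrB big_seq [leRHS]big_seq.
apply: ler_sum => l lL; rewrite Re_sum (bigD1_seq l)//=.
have ll1 : l * l^*%C = 1 by rewrite -nrm_sqr L1// expr1n.
have -> : complex.Re ((p l)^*%C * p l * (\sum_(k < T) (l * l^*%C) ^+ k)) =
    T%:R * nrm (p l) ^+ 2.
  rewrite ll1 (eq_bigr (fun=> 1)) => [|k _]; last by rewrite expr1n.
  by rewrite sumr_const card_ord mulrC [_^*%C * _]mulrC -nrm_sqr -(rmorph_nat
    (real_complex R)) -rmorphM.
rewrite lerD2l mulr_suml -sumrN big_seq_cond [leRHS]big_seq_cond.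
apply: ler_sum => m /andP[mL ml].
rewrite lerNl; apply: (le_trans (ler_norm _)); rewrite normrN.
apply: (le_trans (Re_le_nrm _)); rewrite 2!nrmM nrmJ mulrC.
apply: ler_pM; rewrite ?mulr_ge0 ?nrm_ge0//; last first.
  by rewrite expr2 ler_pM ?nrm_ge0 ?nrm_le_norm1.
apply: nrm_geometric; first by rewrite nrmM nrmJ (L1 lL) (L1 mL) mulr1.
apply: contraNneq ml => lm.
have mm1 : m^*%C * m = 1 by rewrite mulrC -nrm_sqr L1// expr1n.
by rewrite -[m]mul1r -lm -mulrA mm1 mulr1.
Qed.

Let norm1_sqr p : norm1 p ^+ 2 <= (size L)%:R * \sum_(l <- L) nrm (p l) ^+ 2.
Proof.
have -> : norm1 p ^+ 2 = \sum_(l <- L) \sum_(m <- L) nrm (p l) * nrm (p m).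
  by rewrite expr2 /norm1 mulr_suml; apply: eq_bigr => l _; rewrite mulr_sumr.
apply: (le_trans (y := \sum_(l <- L) \sum_(m <- L) (nrm (p l) ^+ 2 + nrm (p m) ^+ 2) /
  2)).
  apply: ler_sum => l _; apply: ler_sum => m _.
  by have := sqr_ge0 (nrm (p l) - nrm (p m)); rewrite ler_pdivlMr// sqrrB; lra.
have cst x : \sum_(m <- L) x = (size L)%:R * x :> R.
  by rewrite big_const_seq count_predT iter_addr_0 mulr_natl.
set Q := \sum_(l <- L) nrm (p l) ^+ 2.
rewrite (eq_bigr (fun l => ((size L)%:R * nrm (p l) ^+ 2 + Q) / 2)) => [|l _].
  by rewrite -mulr_suml big_split/= cst -mulr_sumr -/Q; lra.
by rewrite -mulr_suml big_split/= cst.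
Qed.

(** Put a_k = Re (sum_l (p l)^* l^k), a real number bounded by norm1 p.  As no l
is 1 and the l are distinct, geometric sums give sum_k a_k = O(norm1 p) and
sum_k a_k^2 >= T sum_l |p l|^2 - O(norm1 p ^ 2), both over k < T.  If all a_k
were larger than - c norm1 p, the first estimate would force sum_k a_k^2 to be
at most about c T norm1 p ^ 2, against the second one when c is small and T is
large. *)
Lemma steering : exists (c : R) (T : nat), 0 < c /\
  forall p, self_conj p -> exists2 k, (k < T)%N &
    complex.Re (\sum_(l <- L) (p l)^*%C * l ^+ k) <= - c * norm1 p.
Proof.
have K10 : 0 <= K1 by apply: sumr_ge0 => l _; rewrite divr_ge0// nrm_ge0.
(* s rather than size L, so that the constants make sense for empty L. *)
pose s := (size L).+1%:R : R.
have s0 : 0 < s by rewrite ltr0n.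
have s1 : 1 <= s by rewrite ler1n.
pose T := (Num.truncn (2 * s * (K1 + K2))).+1.
have TK : 2 * s * (K1 + K2) < T%:R by exact: truncnS_gt.
exists (1 / (2 * s)), T; split; first by rewrite divr_gt0// mulr_gt0.
move=> p pJ; apply: contrapT => nok.
pose n := norm1 p.
have ak k : (k < T)%N -> - (1 / (2 * s)) * n < a p k.
  move=> kT; rewrite ltNge; apply/negP => h; apply: nok; by exists k.
have n0 : 0 < n.
  rewrite lt_neqAle norm1_ge0 andbT eq_sym; apply/negP => /eqP n0.
  by have := ak 0%N isT; have := a_le p 0%N; rewrite -/n n0 normr_le0 => /eqP ->;
    rewrite mulr0 ltxx.
pose c := 1 / (2 * s).
have /andP[c0 c1] : 0 < c <= 1.
  by rewrite divr_gt0 ?mulr_gt0//= ler_pdivrMr ?mulr_gt0// mul1r; lra.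
(* Summing 0 <= (a_k + c n) (n - a_k). *)
have h1 : \sum_(k < T) a p k ^+ 2 <=
    (1 - c) * n * (\sum_(k < T) a p k) + T%:R * (c * n ^+ 2).
  rewrite mulr_sumr -[T%:R]/(T%:R) mulr_natl -[X in _ *+ X]card_ord -sumr_const
    -big_split/=.
  apply: ler_sum => k _.
  have := ak k (ltn_ord k); have := a_le p k; rewrite ler_norml -/n -/c => /andP[_ x1] x2.
  have : 0 <= (a p k + c * n) * (n - a p k) by rewrite mulr_ge0//; lra.
  by lra.
have h2 := mean_a p T; have h3 := square_a T pJ.
have h4 : n ^+ 2 <= s * (\sum_(l <- L) nrm (p l) ^+ 2).
  apply: (le_trans (norm1_sqr p)); rewrite ler_wpM2r ?ler_nat//.
  by apply: sumr_ge0 => l _; rewrite sqr_ge0.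
rewrite -/n in h2 h3.
set Q := \sum_(l <- L) _ in h3 h4; set A := \sum_(k < T) a p k in h1 h2.
have n2 : 0 < n ^+ 2 by rewrite exprn_gt0.
have h5 : (1 - c) * n * A <= K1 * n ^+ 2.
  have : (1 - c) * n * A <= (1 - c) * n * (K1 * n).
    by rewrite ler_wpM2l// mulr_ge0 ?subr_ge0// ltW.
  have : 0 <= c * (K1 * n ^+ 2) by exact: (mulr_ge0 (ltW c0) (mulr_ge0 K10 (ltW n2))).
  by lra.
have h6 : T%:R * Q <= (K1 + K2 + T%:R * c) * n ^+ 2 by lra.
have h7 : T%:R * n ^+ 2 <= s * (K1 + K2 + T%:R * c) * n ^+ 2.
  rewrite -mulrA; apply: le_trans (_ : s * (T%:R * Q) <= _).
    by rewrite [leRHS]mulrCA ler_wpM2l.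
  by rewrite ler_wpM2l// ltW.
rewrite ler_pM2r// in h7.
have sc : s * c = 1 / 2 by rewrite /c; field; rewrite gt_eqF.
have : s * (K1 + K2 + T%:R * c) = s * (K1 + K2) + T%:R * (s * c) by ring.
rewrite sc => h8; lra.
Qed.

End Steering.

(** * Expansions in a real base *)

Section Expansions.
Variable R : realType.
Implicit Types (b y : R) (s t : seq nat).

(** The value x_1 / b + ... + x_n / b^n + y / b^n of the digits s followed by a
tail of value y. *)
Definition fval b y s : R := foldr (fun x acc => (x%:R + acc) / b) y s.

Lemma fval_cons b y x s : fval b y (x :: s) = (x%:R + fval b y s) / b.
Proof. by []. Qed.

Lemma fval_cat b y s t : fval b y (s ++ t) = fval b (fval b y t) s.
Proof. exact: foldr_cat. Qed.

Lemma fvalE b y s : fval b y s = fval b 0 s + y / b ^+ size s.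
Proof.
elim: s => [|x s IH]; first by rewrite /= expr0 divr1 add0r.
by rewrite !fval_cons IH [size _]/= exprS invfM; ring.
Qed.

Lemma fval_ge0 b s : 0 < b -> 0 <= fval b 0 s.
Proof.
by move=> b0; elim: s => // x s IH; rewrite fval_cons divr_ge0 ?addr_ge0// ltW.
Qed.

Lemma fval_mono b y y' s : 0 < b -> y <= y' -> fval b y s <= fval b y' s.
Proof.
move=> b0 yy'; rewrite fvalE [leRHS]fvalE lerD2l ler_pM2r// invr_gt0 exprn_gt0//.
Qed.

Lemma fval_lt b s : 0 < b -> fval b 0 s < fval b 1 s.
Proof. by move=> b0; rewrite [ltRHS]fvalE ltrDl divr_gt0// exprn_gt0. Qed.

Lemma fval_le_base b b' s : 0 < b' -> b' <= b -> s != [::] ->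
  fval b 0 s <= b' / b * fval b' 0 s.
Proof.
move=> b'0 b'b; have b0 := lt_le_trans b'0 b'b.
have bb1 : b' / b <= 1 by rewrite ler_pdivrMr// mul1r.
elim: s => [//|x s IH] _; rewrite !fval_cons.
have h : fval b 0 s <= fval b' 0 s.
  have [->//|/IH] := eqVneq s [::]; move/le_trans; apply.
  by rewrite ler_piMl ?fval_ge0.
have -> : b' / b * ((x%:R + fval b' 0 s) / b') = (x%:R + fval b' 0 s) / b.
  by field; rewrite !gt_eqF.
by rewrite ler_pM2r ?invr_gt0// lerD2l.
Qed.

(** Every suffix of s keeps its value at most 1 even when followed by the largest
tail, of value 1.  Unlike admissibility itself, this is stable under
concatenation. *)
Fixpoint full b s : bool :=
  if s is x :: s' then (fval b 1 s <= 1) && full b s' else true.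

Lemma full_fval b s : full b s -> fval b 1 s <= 1.
Proof. by case: s => //= x s /andP[]. Qed.

(** By fullness the tail t has value at most 1, which the condition on s
anticipates. *)
Lemma full_cat b s t : 0 < b -> full b s -> full b t -> full b (s ++ t).
Proof.
move=> b0 sf tf; elim: s sf => //= x s IH /andP[xs /IH ->]; rewrite andbT.
apply: le_trans xs; have := @fval_mono b (fval b 1 t) 1 (x :: s) b0.
by rewrite -fval_cat; apply; exact: full_fval.
Qed.

Lemma full_catr b s t : full b (s ++ t) -> full b t.
Proof. by elim: s => //= x s IH /andP[_ /IH]. Qed.

Lemma full_prefix_lt b t u : 0 < b -> full b (t ++ u) -> fval b 0 t < 1.
Proof.
move=> b0 /full_fval h; apply: lt_le_trans h.
apply: (@le_lt_trans _ _ (fval b 0 (t ++ u))); last exact: fval_lt.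
by rewrite fval_cat; apply: fval_mono => //; exact: fval_ge0.
Qed.

Lemma fval_nseq0 b y n : fval b y (nseq n 0%N) = y / b ^+ n.
Proof.
rewrite fvalE size_nseq (_ : fval b 0 _ = 0) ?add0r//.
by elim: n => // n IH; rewrite [nseq _ _]/= fval_cons IH addr0 mul0r.
Qed.

Lemma full_nseq0 b n : 1 <= b -> full b (nseq n 0%N).
Proof.
move=> b1; elim: n => //= n ->; rewrite andbT.
rewrite -/(fval b 1 _) fval_nseq0 add0r -mulrA -invfM -exprSr mul1r invf_le1.
  exact: exprn_ege1.
by rewrite exprn_gt0// (lt_le_trans ltr01).
Qed.

(** After a digit 1 the remaining room is b - 1, so the zeros must shrink a tail
of value 1 below it. *)
Lemma full_one b G n : 1 <= b -> (b ^+ G)^-1 <= b - 1 -> (G <= n)%N ->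
  full b (1%N :: nseq n 0%N).
Proof.
move=> b1 bG Gn /=; have b0 : 0 < b := lt_le_trans ltr01 b1.
rewrite full_nseq0// andbT -/(fval b 1 _) fval_nseq0 ler_pdivrMr// mul1r mul1r.
have : (b ^+ n)^-1 <= (b ^+ G)^-1 by rewrite lef_pV2 ?posrE ?exprn_gt0// ler_weXn2l.
by lra.
Qed.

(** The first n digits of the greedy expansion of x in base b. *)
Fixpoint gword b n x : seq nat :=
  if n is m.+1 then
    let c := Num.truncn (b * x) in c :: gword b m (b * x - c%:R)
  else [::].

Lemma size_gword b n x : size (gword b n x) = n.
Proof. by elim: n x => //= n IH x; rewrite IH. Qed.

Lemma truncn_frac (x : R) : 0 <= x -> 0 <= x - (Num.truncn x)%:R < 1.
Proof. by move=> /truncn_itv/andP[h1 h2]; rewrite -natr1 in h2; lra. Qed.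

Lemma gword_bounds b n x : 0 < b -> 0 <= x < 1 ->
  fval b 0 (gword b n x) <= x < fval b 0 (gword b n x) + (b ^+ n)^-1.
Proof.
move=> b0; elim: n x => [|n IH] x x01.
  by rewrite /= expr0 invr1 add0r; case/andP: x01 => -> ->.
have /andP[x0 x1] := x01; have bx0 : 0 <= b * x by rewrite mulr_ge0// ltW.
have := IH _ (truncn_frac bx0); rewrite fval_cons.
set c := _%:R; set v := fval b 0 _ => /andP[h1 h2].
have -> : (c + v) / b + (b ^+ n.+1)^-1 = (c + v + (b ^+ n)^-1) / b.
  by rewrite exprS invfM; ring.
rewrite ler_pdivrMr// ltr_pdivlMr//.
by apply/andP; split; lra.
Qed.

Lemma gword_suffix_lt b n x : 0 < b -> 0 <= x < 1 ->
  forall s t, gword b n x = s ++ t -> fval b 0 t < 1.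
Proof.
move=> b0; elim: n x => [|n IH] x x01 [|c s] t //=.
- by move=> <-.
- move=> <-; have := gword_bounds n.+1 b0 x01.
  by case/andP: x01 => _ x1 /andP[vx _]; exact: le_lt_trans x1.
- move=> [_ /IH]; apply; apply: truncn_frac.
  by case/andP: x01 => x0 _; rewrite mulr_ge0// ltW.
Qed.

Lemma gword_digits b n x a : 0 < b -> b <= a%:R -> 0 <= x < 1 ->
  all (fun c => c < a)%N (gword b n x).
Proof.
move=> b0 ba; elim: n x => //= n IH x x01.
case/andP: (x01) => x0 x1; have bx0 : 0 <= b * x by rewrite mulr_ge0// ltW.
rewrite IH ?andbT ?truncn_frac// -(ltr_nat R).
have /andP[h1 _] := truncn_itv bx0; apply: (le_lt_trans h1); apply: lt_le_trans ba.
by rewrite -[ltRHS]mulr1 ltr_pM2l.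
Qed.

(** In base b' every suffix of a greedy word has value less than 1, hence value at
most b' / b in base b; the G zeros make the tail fit into the gap 1 - b' / b. *)
Lemma full_gword b b' G n x : 0 < b' -> b' <= b -> 1 <= b ->
  (b ^+ G)^-1 <= 1 - b' / b -> 0 <= x < 1 ->
  full b (gword b' n x ++ nseq G 0%N).
Proof.
move=> b'0 b'b b1 bG x01; have b0 := lt_le_trans b'0 b'b.
have : forall s t, gword b' n x = s ++ t -> fval b' 0 t < 1.
  exact: gword_suffix_lt.
elim: (gword b' n x) => [_|c w IH suf]; first exact: full_nseq0.
have -> : full b ((c :: w) ++ nseq G 0%N) =
  (fval b 1 ((c :: w) ++ nseq G 0%N) <= 1) && full b (w ++ nseq G 0%N) by [].
rewrite IH ?andbT => [|s t wE]; last by apply: (suf (c :: s)); rewrite wE.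
rewrite fval_cat fval_nseq0 mul1r fvalE.
have h1 : fval b 0 (c :: w) <= b' / b.
  apply: (le_trans (fval_le_base b'0 b'b _)) => //.
  by rewrite ler_piMr ?divr_ge0 ?ltW// (suf [::]).
have h2 : (b ^+ G)^-1 / b ^+ size (c :: w) <= (b ^+ G)^-1.
  rewrite ler_pdivrMr ?exprn_gt0// ler_peMr ?invr_ge0 ?exprn_ge0 ?(ltW b0)//.
  exact: exprn_ege1.
lra.
Qed.

(** When all suffixes have value less than 1, the beta-transformation acts on the
value of a word by deleting its first digit. *)
Lemma e_beta_fval b s : 0 < b ->
  (forall t u, s = t ++ u -> fval b 0 u < 1) ->
  0 <= fval b 0 s < 1 /\
  forall k, (k < size s)%N -> e_beta b (fval b 0 s) k = (nth 0%N s k)%:R.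
Proof.
move=> b0 suf; split; first by rewrite fval_ge0// (suf [::]).
have T x t : fval b 0 t < 1 -> T_beta b (fval b 0 (x :: t)) = fval b 0 t.
  move=> t1; have t0 := fval_ge0 t b0.
  have fl : Num.floor (x%:R + fval b 0 t) = x%:Z.
    by apply: floor_def; rewrite intrD mulr1z -pmulrn; apply/andP; split; lra.
  by rewrite /T_beta fval_cons mulrCA divff ?gt_eqF// mulr1 fl -pmulrn addrAC subrr add0r.
have iterT k : iter k (T_beta b) (fval b 0 s) = fval b 0 (drop k s).
  elim: k => [|k IH]; first by rewrite drop0.
  rewrite iterS IH; have [ks|sk] := ltnP k (size s).
    rewrite (drop_nth 0%N ks) T// (suf (take k.+1 s))// cat_take_drop//.
  rewrite !drop_oversize ?(leq_trans sk)//=.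
  by rewrite /T_beta mulr0 floor0 subrr.
move=> k ks; rewrite /e_beta !iterT (drop_nth 0%N ks) fval_cons.
by rewrite mulrCA divff ?gt_eqF// mulr1 addrK.
Qed.

End Expansions.

(** * Words with almost equal exponential sums *)

Section WordSums.
Variable R : realType.
Implicit Types (z : R[i]) (s t : seq nat).

(** The exponential sum s_0 + s_1 z + s_2 z^2 + ... *)
Definition ev z s : R[i] := foldr (fun x acc => x%:R + z * acc) 0 s.

Lemma ev_cons z x s : ev z (x :: s) = x%:R + z * ev z s.
Proof. by []. Qed.

Lemma ev_cat z s t : ev z (s ++ t) = ev z s + z ^+ size s * ev z t.
Proof.
elim: s => [|x s IH]; first by rewrite /= add0r mul1r.
by rewrite cat_cons !ev_cons IH [size _]/= exprS mulrDr mulrA addrA.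
Qed.

Lemma ev_nseq0 z n : ev z (nseq n 0%N) = 0.
Proof. by elim: n => // n IH; rewrite [nseq _ _]/= ev_cons IH mulr0 addr0. Qed.

Lemma evE z s : ev z s = \sum_(j < size s) (nth 0%N s j)%:R * z ^+ j.
Proof.
elim: s => [|x s IH]; first by rewrite big_ord0.
rewrite ev_cons IH [size _]/= big_ord_recl/= expr0 mulr1 mulr_sumr; congr (_ + _).
by apply: eq_bigr => j _; rewrite /bump exprS mulrCA.
Qed.

Lemma ev_conj z s : ev z^*%C s = (ev z s)^*%C.
Proof.
elim: s => [|x s IH]; first by apply/esym; exact: conjc0.
by rewrite !ev_cons IH rmorphD rmorphM/= conjc_nat.
Qed.

Lemma nrm_nat (n : nat) : nrm (n%:R : R[i]) = n%:R.
Proof. by rewrite -(rmorph_nat (real_complex R)) nrm_real normr_nat. Qed.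

Lemma nrm_ev_le z a s : nrm z = 1 -> all (fun c => c < a)%N s ->
  nrm (ev z s) <= (a * size s)%:R.
Proof.
move=> z1; elim: s => [|x s IH]; first by rewrite /= nrm0.
move=> /= /andP[xa /IH h]; rewrite -/(ev z s) mulnS natrD.
apply: (le_trans (nrmD _ _)); rewrite nrmM z1 mul1r; apply: lerD => //.
by rewrite nrm_nat ler_nat ltnW.
Qed.

Lemma nrm_sqrE z : nrm z ^+ 2 = complex.Re z ^+ 2 + complex.Im z ^+ 2.
Proof. by apply: complexI; rewrite add_Re2_Im2 rmorphXn/= nrmE. Qed.

Lemma Im_le_nrm z : `|complex.Im z| <= nrm z.
Proof.
rewrite -(@ler_pXn2r _ 2)// ?nnegrE ?nrm_ge0//.
by rewrite nrm_sqrE real_normK ?num_real// lerDr sqr_ge0.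
Qed.

Lemma nrm_le_ReIm z : nrm z <= `|complex.Re z| + `|complex.Im z|.
Proof.
rewrite -(@ler_pXn2r _ 2)// ?nnegrE ?nrm_ge0 ?addr_ge0//.
rewrite nrm_sqrE sqrrD !real_normK ?num_real//.
by have : 0 <= `|complex.Re z| * `|complex.Im z| by []; lra.
Qed.

Lemma truncn_eq_dist (x y : R) : 0 <= x -> 0 <= y ->
  Num.truncn x = Num.truncn y -> `|x - y| <= 1.
Proof.
move=> /truncn_itv/andP[x1 x2] /truncn_itv/andP[y1 y2] xy.
rewrite -xy -natr1 in y1 y2; rewrite -natr1 in x2; rewrite ler_norml; lra.
Qed.

Lemma pigeonhole (A B : finType) (f : A -> B) : (0 < #|A|)%N ->
  exists b, (#|A| <= #|[set x | f x == b]%SET| * #|B|)%N.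
Proof.
move=> A0; have /card_gt0P[x0 _] := A0.
pose b := [arg max_(b > f x0) #|[set x | f x == b]%SET|]; exists b.
have bmax b' : (#|[set x | f x == b']%SET| <= #|[set x | f x == b]%SET|)%N.
  by rewrite /b; case: arg_maxnP => // i _; apply.
have -> : #|A| = (\sum_b #|[set x | f x == b]%SET|)%N.
  rewrite -sum1_card (partition_big f xpredT)//=; apply: eq_bigr => b' _.
  by rewrite -sum1_card; apply: eq_bigl => x; rewrite inE.
apply: (@leq_trans (\sum_(b' : B) #|[set x | f x == b]%SET|)%N).
  by apply: leq_sum => b' _; exact: bmax.
by rewrite sum_nat_const mulnC.
Qed.

Lemma gword_inj (b : R) n x y : 0 < b -> 0 <= x < 1 -> 0 <= y < 1 ->
  gword b n x = gword b n y -> `|x - y| < (b ^+ n)^-1.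
Proof.
move=> b0 x01 y01 xy; have := gword_bounds n b0 x01; have := gword_bounds n b0 y01.
rewrite xy ltr_norml; lra.
Qed.

(** The b^N points j / b^N, j < b^N, have distinct greedy words of length N.  The
exponential sums of these words are O(N), so they fall into at most
(K (N + 1)) ^ (2 size L) cells, each of diameter at most eta in every coordinate, and
one cell contains many of them. *)
Lemma many_close_words (L : seq R[i]) (b eta : R) (a : nat) :
  {in L, forall l, nrm l = 1} -> 1 <= b -> b <= a%:R -> 0 < eta ->
  exists K : nat, forall N : nat, exists (q : nat) (W : 'I_q -> seq nat),
  [/\ (0 < q)%N, injective W,
      forall i, exists2 x, 0 <= x < 1 & W i = gword b N x,
      forall i j, {in L, forall l, nrm (ev l (W i) - ev l (W j)) <= eta} &
      b ^+ N <= 2 * (q * (K * N.+1) ^ (2 * size L))%:R].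
Proof.
move=> L1 b1 ba eta0; have b0 : 0 < b := lt_le_trans ltr01 b1.
(* Cells of side eta / 2 in the real and imaginary parts. *)
pose kap := 2 / eta; have kap0 : 0 < kap by rewrite divr_gt0.
pose K := (Num.truncn (2 * a%:R * kap)).+1.
exists K => N.
have bN : 1 <= b ^+ N by exact: exprn_ege1.
pose Q := Num.truncn (b ^+ N).
have Qitv := truncn_itv (le_trans ler01 bN).
have Q0 : (0 < Q)%N by rewrite truncn_gt0.
pose x (i : 'I_Q) : R := i%:R / b ^+ N.
have x01 i : 0 <= x i < 1.
  rewrite divr_ge0 ?exprn_ge0 ?(ltW b0)//= ltr_pdivrMr ?exprn_gt0// mul1r.
  case/andP: Qitv => h _; apply: lt_le_trans h; by rewrite ltr_nat.
pose w i := gword b N (x i).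
have w_inj : injective w.
  move=> i j /(gword_inj b0 (x01 i) (x01 j)).
  rewrite -mulrBl normrM [`|_^-1|]ger0_norm ?invr_ge0 ?exprn_ge0 ?(ltW b0)//.
  rewrite -[ltRHS]mul1r ltr_pM2r ?invr_gt0 ?exprn_gt0// ltr_norml => ij.
  apply/val_inj/eqP; rewrite eqn_leq /=; case/andP: ij => ij1 ij2.
  by apply/andP; split; rewrite -ltnS -(ltr_nat R) -natr1; lra.
have wdig i : all (fun c => c < a)%N (w i) by exact: gword_digits.
pose M := (K * N.+1)%N.
have M0 : (0 < M)%N by rewrite muln_gt0.
pose u (v : R) : 'I_M.-1.+1 := inord (Num.truncn ((v + (a * N)%:R) * kap)).
pose f i : {ffun 'I_(size L) -> 'I_M.-1.+1 * 'I_M.-1.+1} :=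
  [ffun r => (u (complex.Re (ev (tnth (in_tuple L) r) (w i))),
              u (complex.Im (ev (tnth (in_tuple L) r) (w i))))].
have Q0' : (0 < #|'I_Q|)%N by rewrite card_ord.
have [c cQ] := pigeonhole f Q0'.
pose F := [set i | f i == c]%SET.
exists #|F|, (fun i => w (enum_val i)).
have uE v v' : `|v| <= (a * N)%:R -> `|v'| <= (a * N)%:R -> u v = u v' -> `|v - v'| <=
  eta / 2.
  move=> va va'; have bnd (t : R) : `|t| <= (a * N)%:R ->
      0 <= (t + (a * N)%:R) * kap /\ (Num.truncn ((t + (a * N)%:R) * kap) < M)%N.
    rewrite ler_norml => /andP[t1 t2].
    have h0 : 0 <= (t + (a * N)%:R) * kap by rewrite mulr_ge0 ?(ltW kap0)//; lra.
    split => //; rewrite -(ltr_nat R).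
    have /andP[h1 _] := truncn_itv h0; apply: (le_lt_trans h1).
    have h2 : (t + (a * N)%:R) * kap <= 2 * a%:R * kap * N%:R.
      have -> : 2 * a%:R * kap * N%:R = (2 * (a * N)%:R) * kap by rewrite natrM; ring.
      by rewrite ler_wpM2r ?(ltW kap0)//; lra.
    apply: (le_lt_trans h2); rewrite /M natrM.
    have h3 : 2 * a%:R * kap < K%:R by exact: truncnS_gt.
    have h4 : 0 <= 2 * a%:R * kap by apply: mulr_ge0 (ltW kap0); rewrite mulr_ge0.
    have h5 : 2 * a%:R * kap * N%:R <= K%:R * N%:R by rewrite ler_wpM2r// ltW.
    rewrite -natr1; lra.
  have [v0 vM] := bnd v va; have [v'0 v'M] := bnd v' va'.
  move=> /(congr1 val); rewrite /u /= !inordK ?prednK// => /(truncn_eq_dist v0 v'0).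
  rewrite -mulrBl opprD addrACA subrr addr0 normrM (gtr0_norm kap0).
  by rewrite -ler_pdivlMr// /kap invf_div mul1r.
have wE i l : l \in L -> nrm (ev l (w i)) <= (a * N)%:R.
  by move=> lL; rewrite -(size_gword b N (x i)); apply: nrm_ev_le; rewrite ?L1.
have cells : #|{ffun 'I_(size L) -> 'I_M.-1.+1 * 'I_M.-1.+1}| = (M ^ (2 * size L))%N.
  by rewrite card_ffun card_prod !card_ord prednK// expnM expnS expn1.
have F0 : (0 < #|F|)%N.
  by rewrite lt0n; apply: contraTneq cQ => F0; rewrite -/F F0 mul0n card_ord -ltnNge.
split => //.
- by move=> i j /w_inj/enum_val_inj.
- by move=> i; exists (x (enum_val i)).
- move=> i j l lL; have /seq_tnthP[r lr] := lL.
  have := enum_valP i; have := enum_valP j; rewrite !inE => /eqP fj /eqP fi.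
  have : f (enum_val i) r = f (enum_val j) r by rewrite fi fj.
  rewrite !ffunE -lr => -[uRe uIm].
  apply: (le_trans (nrm_le_ReIm _)); rewrite [leRHS](splitr eta); apply: lerD.
    rewrite ReD ReN; apply: uE uRe; apply: (le_trans (Re_le_nrm _)); exact: wE.
  have -> z z' : complex.Im (z - z') = complex.Im z - complex.Im z' by case: z; case: z'.
  apply: uE uIm; apply: (le_trans (Im_le_nrm _)); exact: wE.
- rewrite card_ord cells in cQ.
  have : (Q%:R : R) <= (#|F| * M ^ (2 * size L))%:R by rewrite ler_nat.
  have : 1 <= Q%:R :> R by rewrite ler1n.
  by case/andP: Qitv => _; rewrite -/Q -natr1; lra.
Qed.

End WordSums.

(** * Tame sequences and frequencies of cylinders *)

Section Tame.
Variables (R : realType) (b : R) (L : seq R[i]) (a : nat).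
Hypothesis b_gt1 : 1 < b.
Hypothesis L1 : {in L, forall l, nrm l = 1}.

Definition zext (s : seq nat) : int -> nat :=
  fun z => if z is Posz n then nth 0%N s n else 0%N.

Definition window (y : int -> nat) (t : int) (n : nat) : seq nat :=
  mkseq (fun j => y (t + j%:Z)) n.

(** Every condition bears on finite windows, so that it survives in the limits of
laws carried by such sequences. *)
Definition tame (K : R) : set (int -> nat) := [set y |
  [/\ forall z, (y z < a)%N,
      forall t n, fval b 0 (window y t n) < 1 &
      forall t n, {in L, forall l, nrm (ev l (window y t n)) <= K}]].

Lemma tame_shift K k y : tame K y -> tame K (shift k y).
Proof.
have wE t n : window (shift k y) t n = window y (t + k) n.
  by apply: eq_mkseq => j; rewrite /shift addrAC.
by case=> y1 y2 y3; split => [z|t n|t n]; rewrite ?wE;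
  [exact: y1|exact: y2|exact: y3].
Qed.

Lemma nth_zext A B s (z : int) : - A%:Z <= z ->
  nth 0%N (nseq A 0%N ++ s ++ nseq B 0%N) (absz (z + A%:Z)) = zext s z.
Proof.
move=> Az; rewrite nth_cat size_nseq; case: ltnP => h.
  have -> : zext s z = 0%N by case: z Az h => // n; lia.
  by rewrite nth_nseq h.
case: z Az h => [n _ h|n]; last by lia.
have -> : (absz (n%:Z + A%:Z)%R - A)%N = n by lia.
rewrite /= nth_cat nth_nseq; case: ltnP => // sn.
by rewrite if_same nth_default.
Qed.

Lemma window_zext s t n : exists A B k,
  window (zext s) t n = take n (drop k (nseq A 0%N ++ s ++ nseq B 0%N)).
Proof.
pose A := absz t; pose k := absz (t + A%:Z).
exists A, (k + n)%N, k; set S := _ ++ _.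
have nS : (k + n <= size S)%N by rewrite !size_cat !size_nseq; lia.
have sz : size (take n (drop k S)) = n by rewrite size_take size_drop; case: ltnP; lia.
apply: (@eq_from_nth _ 0%N); rewrite size_mkseq ?sz// => j jn.
rewrite nth_mkseq// nth_take// nth_drop -(@nth_zext A (k + n)%N s) -/S; last by lia.
by congr nth; rewrite /k /A; lia.
Qed.

(** The sum over a window is a difference of two prefix sums, up to a factor of
modulus 1, whence the factor 2. *)
Lemma zext_tame (K : R) s : (0 < a)%N -> full b s -> all (fun x => x < a)%N s ->
  (forall n, {in L, forall l, nrm (ev l (take n s)) <= K}) ->
  tame (2 * K) (zext s).
Proof.
move=> a0 sf sa sK; have b0 : 0 < b := lt_trans ltr01 b_gt1.
have K0 l : l \in L -> 0 <= K by move=> lL; apply: le_trans (sK 0%N l lL); exact: nrm_ge0.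
split => [[n|n]//=|t n|t n l lL].
- have [ns|sn] := ltnP n (size s); last by rewrite nth_default.
  by move/all_nthP : sa => /(_ 0%N n ns).
- have [A [B [k ->]]] := window_zext s t n.
  have SF : full b (nseq A 0%N ++ s ++ nseq B 0%N).
    by apply: full_cat => //; [|apply: full_cat => //]; apply: full_nseq0; exact: ltW.
  rewrite -(cat_take_drop k (_ ++ _)) in SF.
  have /full_catr := SF; rewrite -{1}(cat_take_drop n (drop _ _)).
  exact: full_prefix_lt.
have [A [B [k ->]]] := window_zext s t n.
set S := _ ++ _.
have SK j : nrm (ev l (take j S)) <= K.
  have nK i : nrm (ev l (nseq i 0%N)) <= K by rewrite ev_nseq0 nrm0 (K0 l).
  rewrite /S take_cat size_nseq; case: ifP => [jA|_].
    by rewrite take_nseq ?(ltnW jA).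
  rewrite ev_cat ev_nseq0 add0r nrmM nrmX (L1 lL) expr1n mul1r.
  rewrite take_cat; case: ifP => _; first exact: sK.
  rewrite ev_cat (_ : ev l (take _ (nseq _ _)) = 0) ?mulr0 ?addr0.
    by have := sK (size s) l lL; rewrite take_size.
  move: (_ - _)%N => u; have [uB|Bu] := leqP u B; first by rewrite take_nseq// ev_nseq0.
  by rewrite take_oversize ?size_nseq ?ev_nseq0// ltnW.
have SE : ev l (take (k + n) S) =
    ev l (take k S) + l ^+ size (take k S) * ev l (take n (drop k S)).
  by rewrite takeD ev_cat.
have -> : nrm (ev l (take n (drop k S))) =
    nrm (ev l (take (k + n) S) - ev l (take k S)).
  by rewrite SE [_ + _ * _]addrC addrK nrmM nrmX (L1 lL) expr1n mul1r.
apply: (le_trans (nrmD _ _)); rewrite nrmN.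
by have := SK (k + n)%N; have := SK k; lra.
Qed.

End Tame.

(** The coordinates on which the members of S agree can be replaced freely, which
multiplies S by q ^ r inside the whole space. *)
Lemma card_agree (m q j0 r : nat) (S : {set {ffun 'I_m -> 'I_q}}) :
  (j0 + r <= m)%N ->
  (forall d d', d \in S -> d' \in S ->
    forall i : 'I_m, (j0 <= i < j0 + r)%N -> d i = d' i) ->
  (#|S| * q ^ r <= q ^ m)%N.
Proof.
move=> jm agree.
(* d with its coordinates j0, ..., j0 + r - 1 replaced by g. *)
pose phi (dg : {ffun 'I_m -> 'I_q} * {ffun 'I_r -> 'I_q}) : {ffun 'I_m -> 'I_q} :=
  [ffun i : 'I_m => if (j0 <= i)%N then
     (if insub (i - j0)%N is Some t then dg.2 t else dg.1 i) else dg.1 i].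
have phi_inj : {in finset.setX S [set: {ffun 'I_r -> 'I_q}]%SET &, injective phi}.
  move=> [d g] [d' g']; rewrite !finset.inE /= !andbT => dS d'S.
  move=> /ffunP e; congr pair.
    apply/ffunP => i; have [h|h] := boolP (j0 <= i < j0 + r)%N; first exact: agree.
    have := e i; rewrite !ffunE /=; case: ifP => // ji.
    by rewrite insubN//; apply: contra h => h; rewrite ji; lia.
  apply/ffunP => t; have jt : (j0 + t < m)%N by have := ltn_ord t; lia.
  have := e (Ordinal jt); rewrite !ffunE /= leq_addr addKn.
  by rewrite insubT ?ltn_ord// => lt; rewrite (_ : Sub _ _ = t) //; apply/val_inj.
have := max_card (mem (imset phi (mem (finset.setX S [set: {ffun 'I_r -> 'I_q}]%SET)))).
by rewrite card_in_imset// cardsX cardsT !card_ffun !card_ord.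
Qed.

Lemma sum_tail_le (T n : nat) : (\sum_(k < T) (T < k + n)%N <= n)%N.
Proof.
rewrite -(big_mkord xpredT (fun k => nat_of_bool (T < k + n)%N)).
rewrite (big_cat_nat (n := (T - n)%N)) ?leq_subr//=.
rewrite big_nat big1 ?add0n => [|k /andP[_ kT]]; last by case: ltnP => //; lia.
apply: (@leq_trans (\sum_(T - n <= k < T) 1)%N).
  by apply: leq_sum => k _; case: ltnP.
by rewrite sum_nat_const_nat muln1; lia.
Qed.

Section CylinderFrequency.
Variables (R : realType) (a P q r n : nat).
Variable x : forall m, {ffun 'I_m -> 'I_q} -> int -> nat.
Hypotheses (P_gt0 : (0 < P)%N) (q_gt0 : (0 < q)%N).
Hypothesis rn : (r.+1 * P <= n)%N.
Hypothesis x_lt : forall m d z, (@x m d z < a)%N.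
Hypothesis decode : forall m (d d' : {ffun 'I_m -> 'I_q}) (j : 'I_m),
  (forall i, (i < P)%N -> x d (P * j + i)%N = x d' (P * j + i)%N) -> d j = d' j.

(** A window of length n contains r complete blocks, so for every shift that keeps
the window inside the sampled range E determines r consecutive choices
([card_agree]).  The n other shifts account for the last term. *)
Lemma freq_cylinder_le m (E : set (int -> nat)) :
  (forall y y', (forall z, (y z < a)%N) -> (forall z, (y' z < a)%N) ->
    E y -> E y' -> forall i, (i < n)%N -> y i%:Z = y' i%:Z) ->
  freq R (@x m.+1) (m.+1 * P) E <= (q%:R ^+ r)^-1 + n%:R / (m.+1 * P)%:R.
Proof.
move=> Edet; set T := (m.+1 * P)%N.
have T0 : (0 < T)%N by rewrite muln_gt0.
pose S k : {set {ffun 'I_m.+1 -> 'I_q}} :=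
    [set d | `[< E (shift k%:Z (x d)) >]]%SET.
have qm0 : (0 < q ^ m.+1)%N by rewrite expn_gt0 q_gt0.
have cardS k : (k + n <= T)%N -> (#|S k| * q ^ r <= q ^ m.+1)%N.
  (* The first block that starts after time k. *)
  move=> knT; pose j0 := ((k + P.-1) %/ P)%N.
  have kj0 : (k <= j0 * P)%N.
    have := ltn_ceil (k + P.-1) P_gt0; rewrite -/j0 mulSn; lia.
  have j0k : (j0 * P <= k + P.-1)%N by exact: leq_trunc_div.
  have jT : (j0 + r <= m.+1)%N.
    rewrite -(leq_pmul2r P_gt0) mulnDl; have := rn; rewrite mulSn; rewrite /T in knT; lia.
  apply: (card_agree (j0 := j0) jT) => d d'.
  rewrite !inE => dS d'S i /andP[ji ir].
  have dE : E (shift k%:Z (x d)) by move/asboolP/asboolP: dS.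
  have d'E : E (shift k%:Z (x d')) by move/asboolP/asboolP: d'S.
  apply: decode => u uP.
  have h1 : (k <= P * i)%N by apply: (leq_trans kj0); rewrite mulnC leq_pmul2l.
  have h2 : (P * i + u < k + n)%N.
    have : (P * i.+1 <= P * (j0 + r))%N by rewrite leq_pmul2l.
    rewrite mulnS mulnDr; have := rn; rewrite mulSn; lia.
  have := Edet _ _ _ _ dE d'E (P * i + u - k)%N.
  rewrite /shift (_ : (P * i + u - k)%N%:Z + k%:Z = (P * i + u)%N%:Z); last by lia.
  by apply=> [z|z|]; [exact: x_lt|exact: x_lt|lia].
rewrite /freq card_ffun !card_ord ler_pdivrMr; last by rewrite ltr0n muln_gt0 T0.
have cnt (k : 'I_T) : \sum_(d : {ffun 'I_m.+1 -> 'I_q}) (`[< E (shift (k : nat)%:Z (x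
  d)) >] : nat)%:R <=
    (q ^ m.+1)%:R * ((q%:R ^+ r)^-1 + (T < k + n)%N%:R) :> R.
  have -> : \sum_(d : {ffun 'I_m.+1 -> 'I_q}) (`[< E (shift (k : nat)%:Z (x d)) >] :
    nat)%:R = #|S k|%:R :> R.
    rewrite -sum1_card natr_sum.
    rewrite [RHS]big_mkcond/=; apply: eq_bigr => d _.
    by rewrite inE; case: asboolP.
  have [h|h] := leqP (k + n) T.
    rewrite addr0 ler_pdivlMr ?exprn_gt0 ?ltr0n// -natrX -natrM ler_nat.
    exact: cardS.
  rewrite (_ : true%:R = 1)// mulrDr mulr1 (le_trans (y := (q ^ m.+1)%:R))//.
    by rewrite ler_nat (leq_trans (max_card _))// card_ffun !card_ord.
  by rewrite lerDr mulr_ge0// invr_ge0 exprn_ge0.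
apply: (le_trans (ler_sum _ (fun k _ => cnt k))).
rewrite -mulr_sumr big_split/= sumr_const card_ord -natr_sum.
have h := sum_tail_le T n.
have T0' : (0 : R) < T%:R by rewrite ltr0n.
have -> : ((q%:R ^+ r)^-1 + n%:R / T%:R) * (T * q ^ m.+1)%:R =
    (q ^ m.+1)%:R * ((q%:R ^+ r)^-1 *+ T + n%:R) :> R.
  by rewrite natrM -[_ *+ T]mulr_natl; field; rewrite gt_eqF ?exprn_gt0 ?ltr0n// gt_eqF.
by rewrite ler_wpM2l// lerD2l ler_nat.
Qed.

End CylinderFrequency.

(** * Steered trajectories *)

Lemma iter_shiftZ i (v : linfZ) z : iter i (shiftZ 1) v z = v (z + i%:Z).
Proof.
elim: i z => [|i IH] z; first by rewrite addr0.
rewrite iterS -[LHS]/(iter i (shiftZ 1) v (z + 1)) IH; congr (linfZ_fun v _); lia.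
Qed.

(** The last class collects the letters that do not occur, so that the classes
partition the whole sequence space. *)
Definition digit_class a (z : int) : 'I_a.+1 :=
  inord (if z is Posz n then n else a).


Section Trajectories.
Variables (R : realType) (b : R) (L : seq R[i]) (a T G N q : nat).
Variables (c : R) (W : 'I_q -> seq nat) (i0 : 'I_q).
Hypotheses (b_gt1 : 1 < b) (bG : (b ^+ G)^-1 <= b - 1) (a_gt1 : (1 < a)%N).
Hypothesis L1 : {in L, forall l, nrm l = 1}.
Hypothesis c_gt0 : 0 < c.
Hypothesis steer : forall p, self_conj p -> exists2 k, (k < T)%N &
    complex.Re (\sum_(l <- L) (p l)^*%C * l ^+ k) <= - c * norm1 L p.
Hypothesis W_size : forall i, size (W i) = N.
Hypothesis W_inj : injective W.
Hypothesis W_full : forall i, full b (W i ++ nseq G 0%N).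
Hypothesis W_lt : forall i, all (fun x => x < a)%N (W i).
Variable eta : R.
Hypothesis eta_le : eta <= 1 /\ 2 * eta <= c.
Hypothesis W_close : forall i j, {in L, forall l, nrm (ev l (W i) - ev l (W j)) <= eta}.

Definition pulse k := nseq k 0%N ++ 1%N :: nseq (T - k.+1 + G) 0%N.
(** The zeros at the end of the pulse and at the end of the block make both parts
full. *)
Definition block k i := pulse k ++ W i ++ nseq G 0%N.
Definition period : nat := T + G + (N + G).
Local Notation P := period.

Definition choose_pulse (r : R[i] -> R[i]) : nat :=
  xget 0%N [set k | (k < T)%N /\
    complex.Re (\sum_(l <- L) (r l)^*%C * l ^+ k) <= - c * norm1 L r].

Lemma choose_pulseP r : self_conj r -> (choose_pulse r < T)%N /\
  complex.Re (\sum_(l <- L) (r l)^*%C * l ^+ choose_pulse r) <= - c * norm1 L r.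
Proof.
move=> /steer[k kT kr]; rewrite /choose_pulse.
by case: xgetP => [k' _ //|/(_ k)]; case.
Qed.

Definition word_error i (l : R[i]) : R[i] :=
  l ^+ (T + G) * (ev l (W i) - ev l (W i0)).

(** The position of the walk relative to the periodic walk of the reference word,
seen in the frame that rotates by l^-1 at each step; thus the choice of the pulse
does not depend on the time. *)
Definition next_state (r : R[i] -> R[i]) i : R[i] -> R[i] := fun l =>
  l^-1 ^+ P * (r l + (l ^+ choose_pulse r + word_error i l)).

Fixpoint traj r (ds : seq 'I_q) : seq nat :=
  if ds is d :: ds' then block (choose_pulse r) d ++ traj (next_state r d) ds'
  else [::].

Definition state r (ds : seq 'I_q) := foldl next_state r ds.

Definition energy (r : R[i] -> R[i]) : R := \sum_(l <- L) nrm (r l) ^+ 2.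

Lemma self_conj_next r i : self_conj r -> self_conj (next_state r i).
Proof.
move=> rJ l; rewrite /next_state /word_error !rJ !ev_conj.
by rewrite rmorphM !rmorphXn/= conjc_inv !rmorphD !rmorphM/= !rmorphXn/= rmorphB.
Qed.

Let s := (size L)%:R : R.
Definition energy_bound : R := (4 * s / c) ^+ 2 + 4 * s.

(** The pulse decreases the energy by 2 c norm1 r and the error in the word
increases it by at most 2 eta norm1 r <= c norm1 r, up to a constant 4 s.  So the
energy decreases when norm1 r >= 4 s / c, and otherwise it is at most
norm1 r ^ 2 + 4 s, which is below the bound. *)
Lemma energy_next r i : self_conj r -> energy r <= energy_bound ->
  energy (next_state r i) <= energy_bound.
Proof.
move=> rJ rB; have [kT kr] := choose_pulseP rJ; set k := choose_pulse r in kT kr.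
have [eta1 etac] := eta_le.
have errE : {in L, forall l, nrm (word_error i l) <= eta}.
  move=> l lL; rewrite /word_error nrmM nrmX (L1 lL) expr1n mul1r; exact: W_close.
have stepE : {in L, forall l, nrm (next_state r i l) ^+ 2 <= nrm (r l) ^+ 2
    + 2 * complex.Re ((r l)^*%C * l ^+ k) + c * nrm (r l) + 4}.
  move=> l lL; have el := errE l lL.
  rewrite /next_state nrmM nrmX nrmV (L1 lL) invr1 expr1n mul1r nrm_sqrD mulrDr ReD.
  have h1 : complex.Re ((r l)^*%C * word_error i l) <= nrm (r l) * eta.
    apply: (le_trans (ler_norm _)); apply: (le_trans (Re_le_nrm _)).
    by rewrite nrmM nrmJ ler_wpM2l// nrm_ge0.
  have h2 : nrm (l ^+ k + word_error i l) <= 2.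
    apply: (le_trans (nrmD _ _)); rewrite nrmX (L1 lL) expr1n; lra.
  have h3 : nrm (l ^+ k + word_error i l) ^+ 2 <= 4.
    have -> : 4 = 2 ^+ 2 :> R by rewrite -natrX.
    by rewrite lerXn2r ?nnegrE ?nrm_ge0.
  have h4 : nrm (r l) * (2 * eta) <= nrm (r l) * c by rewrite ler_wpM2l// nrm_ge0.
  rewrite -/k; lra.
have h : energy (next_state r i) <= energy r - c * norm1 L r + 4 * s.
  rewrite /energy; apply: (@le_trans _ _ (\sum_(l <- L) (nrm (r l) ^+ 2
    + 2 * complex.Re ((r l)^*%C * l ^+ k) + c * nrm (r l) + 4))).
    by rewrite big_seq [leRHS]big_seq; exact: ler_sum.
  rewrite !big_split/= -mulr_sumr -mulr_sumr -Re_sum big_const_seq count_predT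
    iter_addr_0.
  by rewrite -/(norm1 L r) -mulr_natl -/s; lra.
have s0 : 0 <= s by exact: ler0n.
have n0 : 0 <= norm1 L r by apply: sumr_ge0 => l _; exact: nrm_ge0.
have [hn|hn] := leP (4 * s) (c * norm1 L r); first by lra.
apply: (le_trans h).
have h5 : energy r <= norm1 L r ^+ 2.
  rewrite expr2 /norm1 mulr_suml; rewrite /energy big_seq [leRHS]big_seq.
  apply: ler_sum => l lL; rewrite expr2 ler_wpM2l ?nrm_ge0//.
  rewrite (big_rem l)//= lerDl; apply: sumr_ge0 => m _; exact: nrm_ge0.
have h6 : norm1 L r ^+ 2 <= (4 * s / c) ^+ 2.
  rewrite lerXn2r ?nnegrE ?divr_ge0 ?mulr_ge0 ?(ltW c_gt0)//.
  by rewrite ler_pdivlMr// mulrC ltW.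
have : 0 <= c * norm1 L r by rewrite mulr_ge0// ltW.
by rewrite /energy_bound; lra.
Qed.

Lemma size_pulse k : (k < T)%N -> size (pulse k) = (T + G)%N.
Proof. by move=> kT; rewrite size_cat /= !size_nseq; lia. Qed.

Lemma size_block k i : (k < T)%N -> size (block k i) = P.
Proof. by move=> kT; rewrite size_cat size_pulse// size_cat W_size size_nseq. Qed.

Lemma full_traj r ds : full b (traj r ds).
Proof.
have b0 : 0 < b := lt_trans ltr01 b_gt1; have b1 := ltW b_gt1.
elim: ds r => //= d ds IH r; apply: full_cat => //.
apply: full_cat => //; apply: full_cat => //; first exact: full_nseq0.
exact: (full_one b1 bG (leq_addl _ _)).
Qed.

Lemma traj_lt r ds : all (fun x => x < a)%N (traj r ds).
Proof.
have a0 : (0 < a)%N by exact: ltnW.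
elim: ds r => //= d ds IH r.
by rewrite !all_cat /= !all_nseq a0 a_gt1 W_lt IH !orbT.
Qed.

Lemma ev_block (l : R[i]) k i : (k < T)%N ->
  ev l (block k i) = l ^+ k + l ^+ (T + G) * ev l (W i).
Proof.
move=> kT; rewrite /block ev_cat size_pulse// ev_cat ev_nseq0 mulr0 addr0.
by rewrite /pulse ev_cat ev_nseq0 add0r size_nseq ev_cons ev_nseq0 mulr0 addr0 mulr1.
Qed.

(** The fixed point of the motion produced by repeating the reference word without
pulses. *)
Definition offset (l : R[i]) : R[i] := l ^+ (T + G) * ev l (W i0) / (l ^+ P - 1).

(** The offset absorbs the reference word, so that the actual position is the
state plus the offset. *)
Lemma ev_traj r ds l : self_conj r -> l \in L -> l ^+ P != 1 ->
  ev l (traj r ds) =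
  l ^+ (P * size ds) * (state r ds l + offset l) - (r l + offset l).
Proof.
move=> rJ lL lP; elim: ds r rJ => [|d ds IH] r rJ.
  by rewrite /= muln0 expr0 mul1r subrr.
have [kT _] := choose_pulseP rJ.
rewrite [traj _ _]/= ev_cat size_block// IH; last exact: self_conj_next.
rewrite ev_block// [state r _]/= -/(state _ ds) [size (_ :: _)]/= mulnS (exprD _ P).
have l0 : l != 0 by rewrite -nrm_eq0 (L1 lL) oner_eq0.
have nE : l ^+ P * next_state r d l =
    r l + (l ^+ choose_pulse r + word_error d l).
  by rewrite /next_state mulrA -exprMn divff// expr1n mul1r.
have oE : l ^+ P * offset l = offset l + l ^+ (T + G) * ev l (W i0).
  rewrite /offset; field; by rewrite subr_eq0.
rewrite /word_error in nE; rewrite mulrBr [X in _ + (_ - X)]mulrDr nE oE; ring.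
Qed.

Lemma energy_state r ds : self_conj r -> energy r <= energy_bound ->
  energy (state r ds) <= energy_bound.
Proof.
elim: ds r => //= d ds IH r rJ rB; apply: IH; first exact: self_conj_next.
exact: energy_next.
Qed.

Lemma take_traj m r ds : self_conj r ->
  take (P * m) (traj r ds) = traj r (take m ds).
Proof.
elim: m r ds => [|m IH] r ds rJ; first by rewrite muln0 !take0.
case: ds => [//|d ds /=].
have [kT _] := choose_pulseP rJ.
rewrite take_cat size_block// mulnS ltnNge leq_addr/= addKn IH//.
exact: self_conj_next.
Qed.

(** The word part of a block sits at a fixed place, so the choices can be read off
without knowing the states. *)
Lemma decode_traj r ds j : self_conj r -> (j < size ds)%N ->
  take N (drop (P * j + (T + G)) (traj r ds)) = W (nth i0 ds j).
Proof.
elim: j r ds => [|j IH] r [|d ds] rJ //= jd; have [kT _] := choose_pulseP rJ.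
  rewrite muln0 add0n /block -catA drop_cat size_pulse// ltnn subnn drop0.
  by rewrite -catA take_cat W_size ltnn subnn take0 cats0.
rewrite drop_cat size_block// mulnS -addnA ltnNge leq_addr/= addKn IH//.
exact: self_conj_next.
Qed.

Let r0 : R[i] -> R[i] := fun=> 0.

Lemma self_conj0 : self_conj r0.
Proof. by move=> l; rewrite /r0 conjc0. Qed.

Let energy0 : energy r0 <= energy_bound.
Proof.
rewrite /energy /r0 big1 => [|l _]; last by rewrite nrm0 expr0n.
by rewrite /energy_bound addr_ge0 ?sqr_ge0 ?mulr_ge0// ler0n.
Qed.

Hypothesis LP : {in L, forall l, l ^+ P != 1}.

Definition prefix_bound : R :=
  energy_bound + 1 + 2 * \sum_(l <- L) nrm (offset l) + (a * P)%:R.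

Lemma ev_traj_le ds l : l \in L -> nrm (ev l (traj r0 ds)) <=
  energy_bound + 1 + 2 * \sum_(l <- L) nrm (offset l).
Proof.
move=> lL; rewrite (ev_traj _ self_conj0 lL (LP lL)).
have o1 : nrm (offset l) <= \sum_(l <- L) nrm (offset l).
  rewrite (big_rem l)//= lerDl; apply: sumr_ge0 => m _; exact: nrm_ge0.
have e1 : nrm (state r0 ds l) <= energy_bound + 1.
  have h : nrm (state r0 ds l) ^+ 2 <= energy_bound.
    apply: le_trans (energy_state ds self_conj0 energy0).
    rewrite /energy (big_rem l)//= lerDl; apply: sumr_ge0 => m _; exact: sqr_ge0.
  have := sqr_ge0 (nrm (state r0 ds l) - 1); rewrite sqrrB;
    have := nrm_ge0 (state r0 ds l); lra.
apply: (le_trans (nrmD _ _)); rewrite nrmN nrmM nrmX (L1 lL) expr1n mul1r.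
have := nrmD (state r0 ds l) (offset l); have := nrmD (r0 l) (offset l).
rewrite {2}/r0 nrm0; lra.
Qed.

Lemma ev_prefix_le ds n l : l \in L ->
  nrm (ev l (take n (traj r0 ds))) <= prefix_bound.
Proof.
move=> lL; have P0 : (0 < P)%N.
  by have [kT _] := choose_pulseP self_conj0; rewrite /period; lia.
set t := traj r0 ds; have nE := divn_eq n P.
have -> : take n t = take (P * (n %/ P)) t ++ take (n %% P) (drop (P * (n %/ P)) t).
  by rewrite -takeD mulnC -nE.
rewrite ev_cat take_traj; last exact: self_conj0.
apply: (le_trans (nrmD _ _)); apply: lerD; first exact: ev_traj_le.
rewrite nrmM nrmX (L1 lL) expr1n mul1r.
apply: (le_trans (nrm_ev_le (a := a) (L1 lL) _)).
  have := traj_lt r0 ds; rewrite -/t -{1}(cat_take_drop (P * (n %/ P)) t) all_cat =>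
    /andP[_].
  by rewrite -{1}(cat_take_drop (n %% P) (drop _ t)) all_cat => /andP[].
rewrite ler_nat leq_mul2l; apply/orP; right.
by rewrite size_take; have := ltn_pmod n P0; case: ifP => ?; lia.
Qed.

Let tr m (d : {ffun 'I_m -> 'I_q}) : seq nat := traj r0 [seq d i | i <- enum 'I_m].

Let x m (d : {ffun 'I_m -> 'I_q}) : int -> nat := zext (tr d).

Let P_gt0 : (0 < P)%N.
Proof. by have [kT _] := choose_pulseP self_conj0; rewrite /period; lia. Qed.

Let q_gt0 : (0 < q)%N.
Proof. exact: leq_ltn_trans (ltn_ord i0). Qed.

Let K : R := 2 * prefix_bound.

Let x_tame m (d : {ffun 'I_m -> 'I_q}) : tame b L a K (x d).
Proof.
apply: (zext_tame b_gt1 L1); first exact: ltnW.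
- exact: full_traj.
- exact: traj_lt.
- by move=> n l lL; exact: ev_prefix_le.
Qed.

Let decode m (d d' : {ffun 'I_m -> 'I_q}) (j : 'I_m) :
  (forall i, (i < P)%N -> x d (P * j + i)%N = x d' (P * j + i)%N) -> d j = d' j.
Proof.
move=> dd'; apply: W_inj.
have dec (e : {ffun 'I_m -> 'I_q}) :
    take N (drop (P * j + (T + G)) (tr e)) = W (e j).
  rewrite decode_traj; [|exact: self_conj0|by rewrite size_map size_enum_ord].
  by rewrite (nth_map j) ?size_enum_ord// nth_ord_enum.
apply: (@eq_from_nth _ 0%N); rewrite !W_size// => u uN.
rewrite -!dec !nth_take// !nth_drop -addnA.
by apply: (dd' (T + G + u)%N); rewrite /period; lia.
Qed.

Let T_infty (e : R) : 0 < e -> \forall m \near \oo, (m.+1 * P)%:R^-1 <= e.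
Proof.
move=> e0; near=> m.
have me : e^-1 <= m%:R by near: m; exact: nbhs_infty_ger.
rewrite -[leRHS]invrK lef_pV2 ?posrE ?invr_gt0 ?ltr0n ?muln_gt0//.
by apply: (le_trans me); rewrite ler_nat (leq_trans (leqnSn m))// leq_pmulr.
Unshelve. all: by end_near. Qed.

(** Choices uniform among q at each block, averaged over the time shifts; a
cylinder of length n fixes all but at most two of the n / P choices it meets, so
its mass is at most exp (2 ln q - n ln q / P). *)
Lemma trajectory_measure : exists nu : probability mlinfZ R,
  [/\ shift_invariant nu,
    forall n E, window_determined n E ->
      (forall y, tame b L a K y -> E (fun z => Posz (y z))) ->
      nu [set v : linfZ | E v] = 1%E &
    ((ln q%:R / P%:R)%:E <= entropy nu (shiftZ 1))%E].
Proof.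
have I_gt0 m : (0 < #|{ffun 'I_m.+1 -> 'I_q}|)%N.
  by rewrite card_ffun !card_ord expn_gt0 q_gt0.
have TP m : (0 < m.+1 * P)%N by rewrite muln_gt0.
have [nu [inv supp freqb]] := krylov_bogoliubov (x := fun m => @x m.+1) TP I_gt0
  T_infty (fun y (h : tame b L a K y) => let: And3 h1 _ _ := h in h1)
  (fun m d k => tame_shift k%:Z (x_tame d)).
exists nu; split => //.
have lq0 : 0 <= ln q%:R :> R by rewrite ln_ge0// ler1n.
pose c0 (v : mlinfZ) := digit_class a ((v : linfZ) 0).
apply: (@entropy_ge _ _ _ nu (shiftZ 1) _ c0 measurable_shiftZ inv _ _ (2 * ln q%:R)).
  move=> i; apply: (@measurable_window 0 [set v | digit_class a (v 0) = i]).
  by move=> v v' vv' /= <-; rewrite vv'.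
move=> n s0.
pose E : set (int -> int) := [set v | forall i : 'I_n, digit_class a (v (i : nat)%:Z) =
  s0 i].
have nE : window_determined n E.
  by move=> v v' vv' Ev i; rewrite -vv'//; have := ltn_ord i; lia.
have -> : [set v : mlinfZ | forall i : 'I_n, c0 (iter i (shiftZ 1) v) = s0 i] =
    [set v : linfZ | E v].
  apply/seteqP; split => v /= h i; have := h i; rewrite /c0 iter_shiftZ add0r//.
have q1 : 1 <= q%:R :> R by rewrite ler1n.
have nlq : n%:R * (ln q%:R / P%:R) = ln q%:R * (n%:R / P%:R) :> R by ring.
(* Windows shorter than a block carry no information: use the bound 1. *)
have [nP|Pn] := ltnP n P.
  apply: (@le_trans _ _ 1).
    have h := probability_le1 nu (measurable_window nE).
    by rewrite -lee_fin fineK//; exact: fin_num_measure (measurable_window nE).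
  rewrite -[leLHS]expR0 ler_expR nlq.
  have : n%:R / P%:R <= 1 :> R by rewrite ler_pdivrMr ?ltr0n// mul1r ler_nat ltnW.
  move=> h; have : ln q%:R * (n%:R / P%:R) <= ln q%:R * 1 :> R by rewrite ler_wpM2l.
  lra.
(* One block is lost because the window need not start at a block. *)
pose r := (n %/ P).-1.
have rS : r.+1 = (n %/ P)%N by rewrite prednK// divn_gt0.
have rn : (r.+1 * P <= n)%N by rewrite rS leq_trunc_div.
have nr : (n <= r.+2 * P)%N by rewrite rS ltnW// ltn_ceil.
apply: (@le_trans _ _ ((q%:R ^+ r)^-1)).
  apply: (freqb n) => // e e0.
  have x_lt m (d : {ffun 'I_m -> 'I_q}) z : (x d z < a)%N by case: (x_tame d).
  have := T_infty (divr_gt0 e0 (ltr0Sn R n)); apply: filterS => m me.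
  have F := @freq_cylinder_le R a P q r n x P_gt0 q_gt0 rn x_lt decode m
    [set y | E (fun z => Posz (y z))].
  apply: (le_trans (F _)).
    move=> y y' ylt y'lt /= Ey Ey' i ilt.
    have := Ey (Ordinal ilt); rewrite -(Ey' (Ordinal ilt)) /digit_class /=.
    by move/(congr1 val); rewrite /= !inordK// ltnW// ltnS ?ylt ?y'lt.
  rewrite lerD2l.
  have h : n%:R * (m.+1 * P)%:R^-1 <= n%:R * (e / n.+1%:R) :> R by rewrite ler_wpM2l.
  apply: (le_trans h); rewrite mulrCA ler_piMr ?(ltW e0)// ler_pdivrMr ?ltr0n//.
  by rewrite mul1r ler_nat.
rewrite -[leLHS]lnK ?posrE ?invr_gt0 ?exprn_gt0 ?ltr0n// ler_expR lnV ?posrE ?exprn_gt0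
  ?ltr0n//.
rewrite lnXn ?ltr0n// -[_ *+ r]mulr_natl.
have nrR : n%:R / P%:R <= r%:R + 2 :> R.
  rewrite ler_pdivrMr ?ltr0n// -natrD -natrM ler_nat addn2//.
have : ln q%:R * (n%:R / P%:R) <= ln q%:R * (r%:R + 2) :> R by rewrite ler_wpM2l.
by rewrite nlq; lra.
Qed.

End Trajectories.

(** * Tame measures of nearly maximal entropy *)

(** The tangent inequality ln t <= t / al + ln al with al so large that A / al is
less than e / 2. *)
Lemma linear_beats_log (R : realType) (A B e : R) : 0 <= A -> 0 < e ->
  exists N : nat, A * ln N.+1%:R + B < N%:R * e.
Proof.
move=> A0 e0; pose al := 2 * A / e + 1.
have al0 : 0 < al by rewrite ltr_wpDl// divr_ge0 ?mulr_ge0// ltW.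
pose B' := A * ln al + B + e / 2.
pose N := (Num.truncn (`|B'| / (e / 2))).+1; exists N.
have NB : B' < N%:R * (e / 2).
  apply: (le_lt_trans (ler_norm _)); rewrite -ltr_pdivrMr ?divr_gt0//.
  exact: truncnS_gt.
have N0 : 0 < N.+1%:R :> R by rewrite ltr0n.
have h : ln N.+1%:R <= N.+1%:R / al + ln al.
  have q0 : 0 < N.+1%:R / al by rewrite divr_gt0.
  have := @le_ln1Dx R (N.+1%:R / al - 1).
  rewrite (_ : 1 + (N.+1%:R / al - 1) = N.+1%:R / al); last by ring.
  rewrite lnM ?posrE ?invr_gt0// lnV ?posrE// => /(_ _).
  have : -1 < N.+1%:R / al - 1 by lra.
  by move=> h1 /(_ h1); lra.
have h2 : A * (N.+1%:R / al) <= N.+1%:R * (e / 2).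
  rewrite mulrCA ler_wpM2l// ler_pdivrMr//.
  have -> : e / 2 * al = A + e / 2 by rewrite /al; field; rewrite gt_eqF.
  by rewrite lerDl divr_ge0// ltW.
have h3 : A * ln N.+1%:R <= A * (N.+1%:R / al + ln al) by rewrite ler_wpM2l.
have h4 : N.+1%:R = N%:R + 1 :> R by rewrite natr1.
rewrite /B' in NB; rewrite h4 in h2 h3 *; lra.
Qed.

Lemma exists_small_power (R : realType) (b e : R) : 1 < b -> 0 < e ->
  exists G : nat, (b ^+ G)^-1 <= e.
Proof.
move=> b1 e0; have b0 : 0 < b := lt_trans ltr01 b1.
have lb : 0 < ln b by rewrite ln_gt0.
pose G := (Num.truncn (`|ln e^-1| / ln b)).+1; exists G.
rewrite -[leRHS]invrK lef_pV2 ?posrE ?invr_gt0 ?exprn_gt0//.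
rewrite -ler_ln ?posrE ?invr_gt0 ?exprn_gt0// lnXn//.
apply: (le_trans (ler_norm _)); rewrite -mulr_natl -ler_pdivrMr// ltW//.
exact: truncnS_gt.
Qed.

Lemma periodE T G N : period T G N = (T + G + G + N)%N.
Proof. by rewrite /period; lia. Qed.



Section TameMeasure.
Variables (R : realType) (b : R) (L : seq R[i]).
Hypothesis b_gt1 : 1 < b.
Hypothesis uL : uniq L.
Hypothesis L1 : {in L, forall l, nrm l = 1}.
Hypothesis LJ : {in L, forall l, (l^*%C) \in L}.
Hypothesis Lroot : {in L, forall l n, (0 < n)%N -> l ^+ n != 1}.

(** With ln b' = ln b - e / 2, the pigeonhole loses only a power of N and the
pulses and zeros a bounded number of letters per block; both are negligible
against N e / 2 for a suitable N. *)
Lemma tame_measure (eps : R) : 0 < eps ->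
  exists (a : nat) (K : R) (nu : probability mlinfZ R),
  [/\ shift_invariant nu,
    forall n E, window_determined n E ->
      (forall y, tame b L a K y -> E (fun z => Posz (y z))) ->
      nu [set v : linfZ | E v] = 1%E &
    ((ln b - eps)%:E < entropy nu (shiftZ 1))%E].
Proof.
(* Shrinking eps keeps b' >= 1, so that greedy words in base b' are plentiful. *)
move=> eps0; pose e := Num.min eps (ln b).
have b0 : 0 < b := lt_trans ltr01 b_gt1.
have lb0 : 0 < ln b by rewrite ln_gt0.
have e0 : 0 < e by rewrite lt_min eps0.
have ee : e <= eps by rewrite ge_min lexx.
have eb : e <= ln b by rewrite ge_min lexx orbT.
pose b' := expR (ln b - e / 2).
have b'0 : 0 < b' by exact: expR_gt0.
have b'1 : 1 <= b' by rewrite -expR0 ler_expR; lra.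
have b'b : b' < b by rewrite -[ltRHS]lnK ?posrE// ltr_expR; lra.
pose a := (Num.truncn b).+2.
have ba : b <= a%:R.
  by apply: ltW; apply: (lt_trans (truncnS_gt b)); rewrite ltr_nat.
have Ln1 : 1 \notin L.
  by apply/negP => /Lroot/(_ 1%N isT); rewrite expr1n eqxx.
have [c [T [c0 steer]]] := steering uL L1 LJ Ln1.
pose eta := Num.min 1 (c / 2).
have eta0 : 0 < eta by rewrite lt_min ltr01 divr_gt0.
have eta_le : eta <= 1 /\ 2 * eta <= c.
  have : eta <= c / 2 by rewrite ge_min lexx orbT.
  by split; [rewrite ge_min lexx|lra].
have [G Gb] : exists G : nat, (b ^+ G)^-1 <= Num.min (b - 1) (1 - b' / b).
  apply: exists_small_power => //.
  by rewrite lt_min !subr_gt0 b_gt1 ltr_pdivrMr// mul1r.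
have [bG bG'] : (b ^+ G)^-1 <= b - 1 /\ (b ^+ G)^-1 <= 1 - b' / b.
  by move: Gb; rewrite le_min => /andP[].
have [K KP] := many_close_words L1 b'1 (le_trans (ltW b'b) ba) eta0.
pose s := (2 * size L)%N.
have [N NP] := linear_beats_log
  (ln 2 + s%:R * ln K.+1%:R + (T + G + G)%:R * (ln b - e)) (ler0n R s)
  (divr_gt0 e0 (ltr0n R 2)).
have [q [W [q0 W_inj WE W_close Wq]]] := KP N.
pose P := period T G N.
have q0' : 0 < q%:R :> R by rewrite ltr0n.
have lq0 : 0 <= ln q%:R :> R by rewrite ln_ge0// ler1n.
have lnq : P%:R * (ln b - e) < ln q%:R.
  have KN0 : 0 < (K.+1 * N.+1)%:R :> R by rewrite ltr0n.
  have h : b' ^+ N <= 2 * (q%:R * (K.+1 * N.+1)%:R ^+ s).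
    apply: (le_trans Wq); rewrite ler_wpM2l// -natrX -natrM ler_nat leq_mul2l.
    have KN t : ((K * N.+1) ^ t <= (K.+1 * N.+1) ^ t)%N.
      by case: t => // t; rewrite leq_exp2r// leq_mul2r leqnSn orbT.
    by rewrite KN orbT.
  have h1 : N%:R * (ln b - e / 2) <= ln 2 + (ln q%:R + s%:R * ln (K.+1 * N.+1)%:R).
    rewrite -[ln b - _]expRK -/b' mulr_natl -lnXn// !mulr_natl -lnXn//.
    rewrite -!lnM ?posrE ?mulr_gt0 ?exprn_gt0//.
    by rewrite ler_ln ?posrE ?mulr_gt0 ?exprn_gt0.
  have h2 : ln (K.+1 * N.+1)%:R = ln K.+1%:R + ln N.+1%:R :> R.
    by rewrite natrM lnM ?posrE ?ltr0n.
  have hP : P%:R = (T + G + G)%:R + N%:R :> R.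
    by rewrite -natrD -periodE.
  rewrite h2 in h1; rewrite hP mulrDl.
  set X := (T + G + G)%:R * _ in NP *; lra.
have W_size i : size (W i) = N by have [x _ ->] := WE i; exact: size_gword.
have W_full i : full b (W i ++ nseq G 0%N).
  by have [x x01 ->] := WE i; apply: full_gword => //; exact: ltW.
have W_lt i : all (fun x => x < a)%N (W i).
  have [x x01 ->] := WE i; apply: gword_digits => //.
  exact: (le_trans (ltW b'b) ba).
have P0 : (0 < P)%N.
  have [k kT _] := steer _ (@self_conj0 R); rewrite /P periodE !addn_gt0.
  by rewrite (leq_ltn_trans _ kT).
have LP : {in L, forall l, l ^+ P != 1} by move=> l lL; exact: Lroot.
have a_gt1 : (1 < a)%N by [].
have [nu [nu1 nu2 nu3]] := trajectory_measure (Ordinal q0) b_gt1 bG a_gt1 L1 c0 steer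
  W_size W_inj W_full W_lt eta_le W_close LP.
exists a, (2 * prefix_bound L a T G N c W (Ordinal q0)), nu; split => //.
apply: lt_le_trans nu3; rewrite lte_fin ltr_pdivlMr ?ltr0n//.
by rewrite mulrC; apply: le_lt_trans lnq; rewrite ler_wpM2l//; lra.
Qed.

End TameMeasure.

(** * Conjugates of modulus one *)

Lemma finite_set_uniq_seq (T : choiceType) (A : set T) : finite_set A ->
  exists2 s : seq T, uniq s & [set` s] = A.
Proof.
move=> /finite_seqP[s ->]; exists (undup s); first exact: undup_uniq.
by apply/seteqP; split => x /=; rewrite mem_undup.
Qed.

Section UnitRoots.
Variables (R : realType) (beta : R) (f : {poly int}).
Hypothesis beta_gt1 : 1 < beta.
Hypothesis hf : is_minpoly beta f.

Let fC : {poly R[i]} := map_poly intr f.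

Lemma finite_Omega : finite_set (@Omega R f).
Proof.
have fC0 : fC != 0.
  by case: hf => fm _ _; rewrite monic_neq0// monic_map.
have [rs fE] := closed_field_poly_normal fC.
apply/finite_seqP; exists rs; apply/seteqP; split => w;
  by rewrite /Omega /= -/fC fE rootZ ?lead_coef_eq0// root_prod_XsubC.
Qed.

(** An irreducible f sharing a root with X^n - 1 divides it, so beta^n = 1, which
contradicts beta > 1. *)
Lemma Omega_root_of_unity (w : R[i]) n : (0 < n)%N -> Omega f w -> w ^+ n != 1.
Proof.
move=> n0 fw; apply/negP => /eqP wn; case: hf => fm firr fb.
pose g : {poly rat} := 'X^n - 1.
have gw : root (map_poly ratr g) w.
  by rewrite rmorphB/= map_polyXn rmorph1 rootE !hornerE wn subrr.
have fw' : root (map_poly ratr (map_poly intr f : {poly rat})) w.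
  rewrite -map_poly_comp (eq_map_poly (g := intr))//.
  by move=> z /=; rewrite ratr_int.
have ncop : ~~ coprimep (map_poly intr f : {poly rat}) g.
  apply/negP; rewrite -(coprimep_map (@ratr R[i])) => /coprimep_root/(_ fw').
  by rewrite -rootE gw.
rewrite irreducible_poly_coprime// negbK in ncop.
have : root (map_poly ratr g) beta.
  apply: (@root_dvdp _ (map_poly ratr (map_poly intr f : {poly rat}))).
    by rewrite dvdp_map.
  rewrite -map_poly_comp (eq_map_poly (g := intr))//.
  by move=> z /=; rewrite ratr_int.
rewrite rmorphB/= map_polyXn rmorph1 rootE !hornerE subr_eq0 => /eqP bn.
by have := exprn_egt1 n beta_gt1; rewrite bn ltxx -lt0n n0.
Qed.

Lemma Omega_conj (w : R[i]) : Omega f w -> Omega f w^*%C.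
Proof.
rewrite /Omega /= -/fC => fw.
rewrite -complex_root_conj (_ : map_poly _ _ = fC)//.
rewrite -map_poly_comp; apply: eq_map_poly => z /=; exact: rmorph_int.
Qed.

Lemma Omega_zeroE : exists L : seq R[i], [/\ uniq L,
  [set` L] = @Omega_zero R f, {in L, forall l, nrm l = 1},
  {in L, forall l, (l^*%C) \in L} &
  {in L, forall l n, (0 < n)%N -> l ^+ n != 1}].
Proof.
have fin : finite_set (@Omega_zero R f) by apply: sub_finite_set finite_Omega => w [].
have [L uL LE] := finite_set_uniq_seq fin.
have memE l : l \in L <-> Omega_zero f l by rewrite -LE.
have N l : l \in L -> nrm l = 1.
  by move/memE => [_ /= /eqP]; rewrite -(rmorph1 (real_complex R)) normc_nrm => /eqP.
exists L; split => //.
- move=> l lL; apply/memE; have [lO lN] := (memE l).1 lL.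
  by split; [exact: Omega_conj|rewrite /= normcJ].
- by move=> l /memE[lO _] n n0; exact: Omega_root_of_unity.
Qed.

End UnitRoots.

(** * The cocycle *)

Section SeriesShift.
Variable R : realType.
Implicit Types u : nat -> R.

Lemma cvg_series_recl u (l : R) :
  series (fun n => u n.+1) @ \oo --> l -> series u @ \oo --> u 0%N + l.
Proof.
move=> ul; rewrite -cvg_shiftS.
have -> : [sequence series u n.+1]_n = (fun n => u 0%N + series (fun n => u n.+1) n).
  apply/funext => n; rewrite /series /=.
  by rewrite big_nat_recl.
by apply: cvgD => //; exact: cvg_cst.
Qed.

Lemma is_cvg_series_geometric_tail u (n0 : nat) (C r : R) : 0 <= r < 1 ->
  (forall i, `|u (n0 + i)%N| <= C * r ^+ i) -> cvgn (series u).
Proof.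
move=> /andP[r0 r1]; elim: n0 u => [|n0 IH] u uC.
  apply: normed_cvg; apply: (@series_le_cvg _ _ (geometric C r)) => [n|n|n|].
  - exact: normr_ge0.
  - by apply: le_trans (uC n).
  - exact: uC.
  - by apply: is_cvg_geometric_series; rewrite ger0_norm.
have /cvg_ex[l ul] : cvgn (series (fun n => u n.+1)).
  by apply: IH => i; have := uC i; rewrite addSn.
exact: (cvgP _ (cvg_series_recl ul)).
Qed.

Lemma lim_series_recl u : cvgn (series (fun n => u n.+1)) ->
  limn (series u) = u 0%N + limn (series (fun n => u n.+1)).
Proof. by move=> /cvg_series_recl/cvg_lim; exact. Qed.

Lemma common_ratio (l : seq R) : {in l, forall x, 0 <= x < 1} ->
  exists r, 0 <= r < 1 /\ {in l, forall x, x <= r}.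
Proof.
elim: l => [|x l IH] lx; first by exists 0; rewrite lexx ltr01.
have [|r [/andP[r0 r1] lr]] := IH; first by move=> y yl; apply: lx; rewrite inE yl orbT.
have /andP[x0 x1] : 0 <= x < 1 by apply: lx; rewrite mem_head.
exists (Num.max x r); split; first by rewrite le_max x0 gt_max x1.
move=> y; rewrite inE => /orP[/eqP ->|/lr yr]; first by rewrite le_max lexx.
by rewrite le_max yr orbT.
Qed.

End SeriesShift.

Section Cocycle.
Variables (R : realType) (f : {poly int}) (b : R[i] -> R[i]) (L : seq R[i]).
Hypothesis finO : finite_set (@Omega R f).
Hypothesis uL : uniq L.
Hypothesis LE : [set` L] = @Omega_zero R f.

Local Notation lc := ((lead_coef f)%:~R^-1 : R[i]).
Local Notation gam w := (lc * b w).
Local Notation g A n := (lc * \sum_(w \in A) (b w * w ^ (n - 1))).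

Let fin_minus : finite_set (@Omega_minus R f).
Proof. by apply: sub_finite_set finO => w []. Qed.
Let fin_zero : finite_set (@Omega_zero R f).
Proof. by apply: sub_finite_set finO => w []. Qed.
Let fin_plus : finite_set (@Omega_plus R f).
Proof. by apply: sub_finite_set finO => w []. Qed.

(** The difference of the two fundamental sequences: the roots outside the unit
circle contribute equally to both, so only those of modulus 1 remain. *)
Definition central (n : int) : R :=
  complex.Re (\sum_(w <- L) gam w * w ^ (n - 1)).

Let central_g n : central n = complex.Re (g (@Omega_zero R f) n).
Proof.
rewrite -LE -fsbig_seq// mulr_sumr /central.
by congr complex.Re; apply: eq_bigr => w _; rewrite mulrA.
Qed.

Lemma w_Delta_sub n : w_Delta_minus f b n - w_Delta_plus f b n = central n.
Proof.
rewrite central_g /w_Delta_minus /w_Delta_plus -ReN -ReD.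
case: ifP => _.
  rewrite fsbigU0//; last by move=> w [[_ /= w1] [_ /= w1']]; rewrite w1' ltxx in w1.
  by congr complex.Re; rewrite /= mulrDr addrAC subrr add0r.
rewrite fsbigU0//; last by move=> w [[_ /= w1] [_ /= w1']]; rewrite w1 ltxx in w1'.
by congr complex.Re; rewrite opprK /= mulrDr addrCA addNr addr0.
Qed.

(** In the two series of xi_star the infinitely many terms involve only the roots
outside, respectively inside, the unit circle; h w is then |w|^-1, respectively
|w|, the ratio of the geometric decay of the powers of w. *)
Let decay (A : set R[i]) (h : R[i] -> R) (z : nat -> int) (n0 : nat) :
  finite_set A ->
  (forall w, A w -> 0 <= h w < 1) ->
  (forall w i, A w -> nrm (w ^ (z (n0 + i)%N - 1)) <= h w ^+ i) ->
  forall (v : nat -> R) (M : R), (forall n, `|v n| <= M) ->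
  forall u : nat -> R,
  (forall i, `|u (n0 + i)%N| = `|v (n0 + i)%N * complex.Re (g A (z (n0 + i)%N))|) ->
  cvgn (series u).
Proof.
move=> fA hA zh v M vM u uE.
have [s us sE] := finite_set_uniq_seq fA.
have sA w : w \in s -> A w by rewrite -sE.
have [r [r01 sr]] : exists r, 0 <= r < 1 /\ {in [seq h w | w <- s], forall x, x <= r}.
  by apply: common_ratio => _ /mapP[w /sA/hA ? ->].
pose C := M * (nrm lc * \sum_(w <- s) nrm (b w)).
apply: (@is_cvg_series_geometric_tail _ u n0 C r r01) => i.
rewrite uE normrM /C -mulrA; apply: ler_pM => //; rewrite ?mulr_ge0 ?nrm_ge0//.
apply: (le_trans (Re_le_nrm _)); rewrite nrmM -mulrA ler_wpM2l ?nrm_ge0//.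
rewrite -sE -fsbig_seq// (le_trans (nrm_sum _ _))// mulr_suml.
rewrite big_seq [leRHS]big_seq; apply: ler_sum => w ws.
rewrite nrmM ler_wpM2l ?nrm_ge0// (le_trans (zh _ _ (sA _ ws)))//.
have /andP[h0 _] := hA _ (sA _ ws); have /andP[r0 _] := r01.
by rewrite lerXn2r// sr// map_f.
Qed.

Let nrm_int (x M : int) : `|x| <= M -> `|x%:~R : R| <= M%:~R.
Proof. by move=> xM; rewrite -intr_norm ler_int. Qed.

Let series_minus_cvg (v : int -> int) k : bounded_seq v ->
  cvgn (series (fun n : nat =>
    (v n%:Z)%:~R * shift (- n%:Z) (w_Delta_minus f b) k)).
Proof.
move=> [M vM]; apply: (@decay (@Omega_plus R f) (fun w => (nrm w)^-1)
  (fun n => k - n%:Z) (absz k) fin_plus _ _ (fun n => (v n%:Z)%:~R) M%:~R).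
- move=> w [_ /=]; rewrite nrmE -(rmorph1 (real_complex R)) ltcR => w1.
  by rewrite invr_ge0 nrm_ge0 invf_lt1// (lt_trans _ w1).
- move=> w i [_ /=]; rewrite nrmE -(rmorph1 (real_complex R)) ltcR => w1.
  have -> : k - (absz k + i)%N%:Z - 1 = - (absz ((absz k)%:Z + i%:Z + 1 - k)%R)%:Z by lia.
  rewrite -exprnN nrmV nrmX -exprVn.
  apply: ler_wiXn2l; rewrite ?invr_ge0 ?nrm_ge0 ?invf_le1 ?(ltW w1)//;
    [exact: lt_trans w1|lia].
- by move=> n; exact: nrm_int.
- move=> i; rewrite /shift /w_Delta_minus.
  case: ifP => [h|_]; first by exfalso; lia.
  by rewrite ReN mulrN normrN.
Qed.

Let series_plus_cvg (v : int -> int) k : bounded_seq v ->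
  cvgn (series (fun j : nat =>
    (v (- j.+1%:Z))%:~R * shift j.+1%:Z (w_Delta_plus f b) k)).
Proof.
move=> [M vM]; apply: (@decay (@Omega_minus R f) (@nrm R)
  (fun j => k + j.+1%:Z) (absz k) fin_minus _ _ (fun j => (v (- j.+1%:Z))%:~R) M%:~R).
- move=> w [_ /=]; rewrite nrmE -(rmorph1 (real_complex R)) ltcR => w1.
  by rewrite nrm_ge0.
- move=> w i [_ /=]; rewrite nrmE -(rmorph1 (real_complex R)) ltcR => w1.
  have -> : k + (absz k + i)%N.+1%:Z - 1 = (absz (k + (absz k)%:Z + i%:Z)%R)%:Z by lia.
  rewrite -exprnP nrmX; apply: ler_wiXn2l; rewrite ?nrm_ge0 ?(ltW w1)//; lia.
- by move=> n; exact: nrm_int.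
- move=> i; rewrite /shift /w_Delta_plus.
  by case: ifP => // h; exfalso; lia.
Qed.

(** Shifting v moves the single index 0 from one series to the other; the change is
v_0 times the difference of the fundamental sequences. *)
Lemma xi_star_step (v : int -> int) k : bounded_seq v ->
  xi_star f b v (k + 1) - xi_star f b (shift 1 v) k =
  (v 0)%:~R * central (k + 1).
Proof.
move=> vb; rewrite /xi_star.
have vb1 : bounded_seq (shift 1 v) by case: vb => M vM; exists M => n; exact: vM.
pose um (v : int -> int) k (n : nat) : R :=
  (v n%:Z)%:~R * shift (- n%:Z) (w_Delta_minus f b) k.
pose up (v : int -> int) k (j : nat) : R :=
  (v (- j.+1%:Z))%:~R * shift j.+1%:Z (w_Delta_plus f b) k.
rewrite -/(um v (k + 1)) -/(um (shift 1 v) k) -/(up v (k + 1)) -/(up (shift 1 v) k).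
have umE : um (shift 1 v) k = fun n => um v (k + 1) n.+1.
  apply/funext => n; rewrite /um /shift.
  by congr (_%:~R * w_Delta_minus f b _); [congr v|]; lia.
have upE : up v (k + 1) = fun n => up (shift 1 v) k n.+1.
  apply/funext => n; rewrite /up /shift.
  by congr (_%:~R * w_Delta_plus f b _); [congr v|]; lia.
have c1 : cvgn (series (um (shift 1 v) k)) by exact: series_minus_cvg.
have c2 : cvgn (series (up v (k + 1))) by exact: series_plus_cvg.
rewrite umE in c1; rewrite upE in c2.
rewrite umE upE (lim_series_recl c1) (lim_series_recl c2) -w_Delta_sub.
rewrite /um /up /shift oppr0 addr0 addNr -[k + 1%:Z]/(k + 1); ring.
Qed.

Definition central_sum (v : int -> int) (t : int) (m : nat) (c : int) : R :=
  \sum_(j < m) (v (t + (j : nat)%:Z))%:~R * central (c - (j : nat)%:Z).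

Lemma cocycle_nat (m : nat) (v : linfZ) k :
  cocycle_d f b m%:Z v k = central_sum v 0 m (k + m%:Z).
Proof.
elim: m k => [|m IH] k.
  rewrite /central_sum big_ord0 /cocycle_d /shift addr0.
  have -> : (shiftZ 0 v : int -> int) = v by apply/funext => z; rewrite /= /shift addr0.
  by rewrite subrr.
have vb : bounded_seq (shiftZ m%:Z v : int -> int) := bounded_shift m%:Z v.
have h1 := IH (k + 1); have h2 := xi_star_step k vb.
have s1 : shift 1 (shiftZ m%:Z v : int -> int) = (shiftZ m.+1%:Z v : int -> int).
  by apply/funext => z; rewrite /= /shift; congr (linfZ_fun v _); lia.
rewrite s1 in h2.
have e : k + m.+1%:Z = k + 1 + m%:Z by lia.
rewrite /central_sum big_ord_recr/= -/(central_sum v 0 m (k + m.+1%:Z)) e -h1.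
have -> : k + 1 + m%:Z - m%:Z = k + 1 by lia.
rewrite -[v (0 + m%:Z)]/((shiftZ m%:Z v) 0) -h2 /cocycle_d /shift e.
by rewrite addrA subrK.
Qed.

(** The cocycle identity d(-m, v) = - sigma^(-m) d(m, sigma^(-m) v). *)
Lemma cocycle_negz (m : nat) (v : linfZ) k :
  cocycle_d f b (- m%:Z) v k = - central_sum v (- m%:Z) m k.
Proof.
have h := cocycle_nat m (shiftZ (- m%:Z) v) (k - m%:Z).
have <- : central_sum (shiftZ (- m%:Z) v) 0 m (k - m%:Z + m%:Z) =
    central_sum v (- m%:Z) m k.
  rewrite /central_sum subrK; apply: eq_bigr => j _; congr ((linfZ_fun v _)%:~R * _).
  by rewrite add0r addrC.
rewrite -h /cocycle_d /shift subrK opprB.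
have -> : (shiftZ m%:Z (shiftZ (- m%:Z) v) : int -> int) = v.
  by apply/funext => z; rewrite /= /shift; congr (linfZ_fun v _); lia.
by [].
Qed.

Lemma cocycleE n : exists (s : R) (t : int) (m : nat) (c : int), `|s| <= 1 /\
  forall (v : linfZ) k, cocycle_d f b n v k = s * central_sum v t m (k + c).
Proof.
case: n => m; [exists 1, 0, m, m%:Z|exists (-1), (- m.+1%:Z), m.+1, 0].
  by rewrite normr1; split => // v k; rewrite mul1r; exact: cocycle_nat.
by rewrite normrN1; split => // v k; rewrite mulN1r addr0 -cocycle_negz.
Qed.

Hypothesis L1 : {in L, forall l, nrm l = 1}.

Let gamma_norm : R := \sum_(w <- L) nrm (gam w).

Let nrm_exprz w (n : int) : w \in L -> nrm (w ^ n) = 1.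
Proof.
move=> /L1 w1; case: n => n; first by rewrite -exprnP nrmX w1 expr1n.
by rewrite NegzE -exprnN nrmV nrmX w1 expr1n invr1.
Qed.

Let L_neq0 w : w \in L -> w != 0.
Proof. by move=> /L1 w1; rewrite -nrm_eq0 w1 oner_eq0. Qed.

(** The factor l^(c - 1) has modulus 1, and (l^-1)^j is the conjugate of l^j. *)
Lemma central_sum_le (v : int -> int) t m c (K : R) :
  {in L, forall l, nrm (\sum_(j < m) (v (t + (j : nat)%:Z))%:~R * l ^+ j) <= K} ->
  `|central_sum v t m c| <= gamma_norm * K.
Proof.
move=> vK.
have -> : central_sum v t m c = complex.Re (\sum_(w <- L) gam w * w ^ (c - 1) *
    (\sum_(j < m) (v (t + (j : nat)%:Z))%:~R * w ^+ j)^*%C).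
  transitivity (complex.Re (\sum_(j < m) \sum_(w <- L)
      gam w * w ^ (c - 1) * ((v (t + (j : nat)%:Z))%:~R * w ^+ j)^*%C)).
    rewrite Re_sum; apply: eq_bigr => j _.
    rewrite /central -ReZ rmorph_int mulr_sumr; congr complex.Re.
    rewrite big_seq [RHS]big_seq; apply: eq_bigr => w wL.
    rewrite rmorphM rmorph_int/= rmorphXn/= -(nrm1_inv (L1 wL)).
    have -> : c - (j : nat)%:Z - 1 = (c - 1) + (- (j : nat)%:Z) by lia.
    rewrite (expfzDr _ _ (L_neq0 wL)) -exprnN -exprVn; ring.
  congr complex.Re; rewrite exchange_big/=; apply: eq_bigr => w _.
  by rewrite rmorph_sum mulr_sumr.
apply: (le_trans (Re_le_nrm _)); apply: (le_trans (nrm_sum _ _)).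
rewrite /gamma_norm mulr_suml big_seq [leRHS]big_seq; apply: ler_sum => w wL.
by rewrite !nrmM nrm_exprz// mulr1 nrmJ ler_wpM2l ?mulr_ge0 ?nrm_ge0// vK.
Qed.

Let central_le n : `|central n| <= gamma_norm.
Proof.
apply: (le_trans (Re_le_nrm _)); apply: (le_trans (nrm_sum _ _)).
rewrite /gamma_norm big_seq [leRHS]big_seq; apply: ler_sum => w wL.
by rewrite nrmM nrm_exprz// mulr1.
Qed.

Let central_annihilated n : poly_shift f central n = 0.
Proof.
transitivity (complex.Re (\sum_(w <- L) gam w * w ^ (n - 1) *
    (map_poly intr f : {poly R[i]}).[w])).
  transitivity (complex.Re (\sum_(j < size f) \sum_(w <- L)
      gam w * w ^ (n - 1) * ((f`_j)%:~R * w ^+ j))).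
    rewrite Re_sum; apply: eq_bigr => j _; rewrite /shift /central.
    rewrite -ReZ rmorph_int mulr_sumr; congr complex.Re.
    rewrite big_seq [RHS]big_seq; apply: eq_bigr => w wL.
    have -> : n + (j : nat)%:Z - 1 = (n - 1) + (j : nat)%:Z by lia.
    rewrite (expfzDr _ _ (L_neq0 wL)) -exprnP; ring.
  congr complex.Re; rewrite exchange_big/=; apply: eq_bigr => w _.
  rewrite -mulr_sumr; congr (_ * _).
  rewrite -[f in RHS]coefK poly_def rmorph_sum/= horner_sum; apply: eq_bigr => j _.
  by rewrite linearZ/= map_polyXn hornerZ hornerXn.
rewrite big_seq big1// => w wL.
have : Omega_zero f w by rewrite -LE.
by case; rewrite /Omega /= rootE => /eqP -> _; rewrite mulr0.
Qed.

Lemma cocycle_in_W_zero n (v : linfZ) : W_zero f (cocycle_d f b n v).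
Proof.
have [s [t [m [c [s1 vE]]]]] := cocycleE n; split.
  pose M := \sum_(j < m) `|(v (t + (j : nat)%:Z))%:~R| * gamma_norm.
  exists M => k; rewrite vE normrM (le_trans (ler_piMl (normr_ge0 _) s1))//.
  apply: (le_trans (ler_norm_sum _ _ _)); apply: ler_sum => j _.
  by rewrite normrM ler_wpM2l.
move=> k; rewrite /poly_shift.
transitivity (s * \sum_(j < m) (v (t + (j : nat)%:Z))%:~R *
    poly_shift f central (k + c - (j : nat)%:Z)).
  transitivity (s * \sum_(i < size f) \sum_(j < m) (v (t + (j : nat)%:Z))%:~R *
      ((f`_i)%:~R * central (k + (i : nat)%:Z + c - (j : nat)%:Z))).
    rewrite mulr_sumr; apply: eq_bigr => i _; rewrite /shift vE mulrCA; congr (_ * _).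
    by rewrite /central_sum mulr_sumr; apply: eq_bigr => j _; ring.
  rewrite exchange_big/=; congr (_ * _); apply: eq_bigr => j _.
  rewrite /poly_shift mulr_sumr; apply: eq_bigr => i _; rewrite /shift.
  by congr (_ * (_ * central _)); ring.
by rewrite big1 ?mulr0// => j _; rewrite central_annihilated mulr0.
Qed.

Definition cocycle_compact (K : R) : set {ptws int -> R} :=
  [set g | W_zero f g /\ forall n, `|g n| <= K].

(** The bound cuts out a compact cube of the product by Tychonoff's theorem, and
each equation f(sigma) g = 0 at a coordinate is a closed condition. *)
Lemma compact_cocycle_compact K : compact (cocycle_compact K).
Proof.
pose cube := [set g : {ptws int -> R} | forall n : int, `[- K, K]%classic (g n)].
have ccube : compact cube.
  exact: (@tychonoff int (fun=> R) (fun=> `[- K, K]%classic)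
    (fun=> @segment_compact R (- K) K)).
pose Z n := [set g : {ptws int -> R} | poly_shift f g n = 0].
(* The recurrence at n as a finite linear form in the coordinates. *)
pose l n : seq (R * int) :=
  [seq ((f`_(nat_of_ord j))%:~R, n + (nat_of_ord j)%:Z)
      | j <- index_enum 'I_(size f)].
have cZ n : closed (Z n).
  have -> : Z n = (fun g : {ptws int -> R} => \sum_(x <- l n) x.1 * g x.2) @^-1` [set 0].
    by apply/seteqP; split => g; rewrite /Z/= /l big_map.
  apply: preimage_closed; last exact: closed_eq.
  by move=> g _; exact: ptws_sum_continuous.
have -> : cocycle_compact K = cube `&` \bigcap_n (Z n).
  apply/seteqP; split => g /=.
    move=> [[_ gf] gK]; split => [n|n _]; last exact: gf.
    by rewrite /= in_itv/= -ler_norml.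
  move=> [gK gf]; have gK' n : `|g n| <= K.
    by have := gK n; rewrite /= in_itv/= -ler_norml.
  by split => //; split => [|n]; [exists K|exact: gf].
apply: (subclosed_compact _ ccube); last by move=> g [].
apply: closedI; last by apply: closed_bigI => n _; exact: cZ.
have -> : cube = \bigcap_n ((fun g : {ptws int -> R} => g n) @^-1` `[- K, K]%classic).
  by apply/seteqP; split => g h n; [move=> _; exact: h|exact: h].
apply: closed_bigI => n _; apply: preimage_closed; last exact: interval_closed.
by move=> g _; have h := @proj_continuous int (fun=> R) n g; exact: h.
Qed.

Lemma cocycle_event n k (K K0 : R) : gamma_norm * K0 <= K ->
  exists (N : nat) (E : set (int -> int)), [/\ window_determined N E,
    forall v : linfZ, E v <-> `|cocycle_d f b n v k| <= K &
    forall y : int -> nat,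
      (forall t m, {in L, forall l, nrm (ev l (window y t m)) <= K0}) ->
      E (fun z => Posz (y z))].
Proof.
move=> KK; have [s [t [m [c [s1 vE]]]]] := cocycleE n.
exists (absz t + m)%N, [set v | `|s * central_sum v t m (k + c)| <= K]; split.
- move=> v v' vv' /=; suff -> : central_sum v t m (k + c) = central_sum v' t m (k + c)
  by [].
  by apply: eq_bigr => j _; rewrite vv'//; have := ltn_ord j; lia.
- by move=> v; rewrite vE.
move=> y yK /=; rewrite normrM (le_trans (ler_piMl (normr_ge0 _) s1))//.
apply: le_trans KK; apply: central_sum_le => l lL.
have -> : \sum_(j < m) (Posz (y (t + (j : nat)%:Z)))%:~R * l ^+ j = ev l (window y t m).
  by rewrite evE size_mkseq; apply: eq_bigr => j _; rewrite nth_mkseq.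
exact: yK.
Qed.

End Cocycle.

(** * The beta-shift and the theorem *)

Lemma probability_bigcap1 d (X : measurableType d) (R : realType)
    (mu : probability X R) (T : countType) (F : T -> set X) :
  (forall t, measurable (F t)) -> (forall t, mu (F t) = 1%E) ->
  mu (\bigcap_t F t) = 1%E.
Proof.
move=> mF F1.
pose G (n : nat) : set X := if unpickle n is Some t then ~` F t else set0.
have mG n : measurable (G n).
  by rewrite /G; case: unpickle => // t; exact: measurableC.
have G0 n : mu (G n) = 0%E.
  by rewrite /G; case: unpickle => // t; rewrite probability_setC// F1 subee.
have FG : \bigcap_t F t = ~` \bigcup_n G n.
  apply/seteqP; split => x.
    move=> Fx [n _]; rewrite /G; case: unpickle => // t; apply; exact: Fx.
  move=> nG t _; apply: contrapT => nF; apply: nG.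
  by exists (pickle t) => //; rewrite /G pickleK.
have mUG : measurable (\bigcup_n G n) by exact: bigcupT_measurable.
rewrite FG probability_setC// (_ : mu (\bigcup_n G n) = 0%E) ?sube0//.
apply/(negligibleP mu mUG); apply: negligible_bigcup => n.
by apply/(negligibleP mu (mG n)); exact: G0.
Qed.

Section BetaShiftEvents.
Variables (R : realType) (b : R).

Lemma e_beta_floor x k :
  e_beta b x k = (Num.floor (b * iter k (T_beta b) x))%:~R.
Proof. by rewrite /e_beta iterS {2}/T_beta opprB addrCA subrr addr0. Qed.

(** Both sides are integer valued, so two sequences that are close on finitely many
coordinates agree there. *)
Lemma V_beta_plusP (g : nat -> int) :
  V_beta_plus b (fun k => (g k)%:~R) <->
  forall n, exists2 x : R, 0 <= x < 1 &
    forall k, (k < n)%N -> e_beta b x k = (g k)%:~R.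
Proof.
pose gR : {ptws nat -> R} := fun k => (g k)%:~R.
split=> [gV n|gx].
  pose B := [set h : {ptws nat -> R} | forall k, (k < n)%N -> ball (gR k) 1 (h k)].
  have nB : nbhs gR B.
    rewrite /B; elim: n {B} => [|n IH].
      by apply: filterS (@filterT _ (nbhs gR) _) => h _ k.
    have hn : nbhs gR ((fun h : {ptws nat -> R} => h n) @^-1` ball (gR n) 1).
      have := @proj_continuous nat (fun=> R) n gR; apply; exact: nbhsx_ballx.
    apply: filterS (filterI IH hn) => h [h1 h2] k.
    by rewrite ltnS leq_eqVlt => /orP[/eqP ->//|]; exact: h1.
  have [_ [[x /= x01 <-] xB]] := gV B nB.
  exists x; first by rewrite in_itv in x01.
  move=> k kn; have := xB k kn; rewrite e_beta_floor /ball/= -intrB -intr_norm.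
  rewrite -[1]/(1%:~R) ltr_int => h; congr (_%:~R); lia.
have /choice[x xP] : forall n, exists x : R, 0 <= x < 1 /\
    forall k, (k < n)%N -> e_beta b x k = (g k)%:~R.
  by move=> n; have [x x01 xg] := gx n; exists x.
have cvg : {ptws, (fun n => e_beta b (x n)) @ \oo --> gR}.
  apply/pointwise_cvgP => k.
  have : (fun n => e_beta b (x n) k) @ \oo --> gR k.
    apply: cvg_near_cst; near=> n.
    by apply: (xP n).2; near: n; exact: nbhs_infty_gt.
  exact.
move=> B /cvg [N _ NB]; exists (e_beta b (x N)); split; last by apply: NB => /=.
by exists (x N) => //=; rewrite in_itv/=; exact: (xP N).1.
Unshelve. all: by end_near. Qed.

Definition V_beta_event (i : int * nat) : set (int -> int) :=
  [set v | exists2 x : R, 0 <= x < 1 &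
    forall k, (k < i.2)%N -> e_beta b x k = (v (i.1 + 1 + k%:Z))%:~R].

Lemma V_beta_eventE :
  V_beta b = \bigcap_i [set v : linfZ | V_beta_event i v].
Proof.
apply/seteqP; split => v.
  by move=> vV [n l] _; exact: (V_beta_plusP _).1 (vV n) l.
by move=> vE n; apply/(V_beta_plusP _) => l; exact: (vE (n, l) I).
Qed.

Lemma window_determined_V_beta i :
  window_determined (absz i.1 + 1 + i.2)%N (V_beta_event i).
Proof.
case: i => n l v v' vv' [x x01 xv]; exists x => // k kl.
by rewrite xv// vv'//=; move: kl => /=; lia.
Qed.

Lemma drop_window y t n j : (j <= n)%N ->
  drop j (window y t n) = window y (t + j%:Z) (n - j).
Proof.
move=> jn; apply: (@eq_from_nth _ 0%N); rewrite size_drop !size_mkseq// => i ilt.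
by rewrite nth_drop !nth_mkseq; [congr y; lia|lia|lia].
Qed.

Lemma tame_V_beta (L : seq R[i]) a K i y : 0 < b -> tame b L a K y ->
  V_beta_event i (fun z => Posz (y z)).
Proof.
move=> b0 [_ ylt _]; case: i => n l; set s := window y (n + 1) l.
have suf t u : s = t ++ u -> fval b 0 u < 1.
  move=> stu; have sl : size s = l by rewrite size_mkseq.
  have tl : (size t <= l)%N by rewrite -sl stu size_cat leq_addr.
  have -> : u = drop (size t) s by rewrite stu drop_size_cat.
  by rewrite /s drop_window.
have [x01 xE] := e_beta_fval b0 suf.
exists (fval b 0 s) => //= k kl.
by rewrite xE ?size_mkseq// nth_mkseq// -pmulrn.
Qed.

End BetaShiftEvents.

Theorem theorem7p1 (R : realType) (beta : R) (f : {poly int}) (b : R[i] -> R[i])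
    (hbeta : Salem_number beta) (hf : is_minpoly beta f)
    (hb : partial_fraction_coefs f b) (eps : R) (heps : 0 < eps) :
  exists nu : probability mlinfZ R,
    [/\ nu (V_beta beta) = 1%E,
        shift_invariant nu,
        d_bounded f b nu &
        ((ln beta - eps)%:E < entropy nu (shiftZ 1))%E].
Proof.
have [beta_gt1 _ _] := hbeta; have beta0 : 0 < beta := lt_trans ltr01 beta_gt1.
have [L [uL LE L1 LJ Lroot]] := Omega_zeroE beta_gt1 hf.
have finO := finite_Omega hf.
have [a [K [nu [inv supp ent]]]] := tame_measure beta_gt1 uL L1 LJ Lroot heps.
exists nu; split => //.
  rewrite V_beta_eventE; apply: probability_bigcap1 => i.
    exact: (measurable_window (@window_determined_V_beta R beta i)).
  apply: (supp _ _ (@window_determined_V_beta R beta i)) => y; exact: tame_V_beta.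
pose G := \sum_(w <- L) nrm ((lead_coef f)%:~R^-1 * b w).
exists (cocycle_compact f (G * K)); split.
- exact: compact_cocycle_compact.
- by move=> g [].
rewrite (_ : [set v | _] = \bigcap_(i : int * int)
    [set v : linfZ | `|cocycle_d f b i.1 v i.2| <= G * K]); last first.
  apply/seteqP; split => v.
    by move=> vC [n k] _; exact: (vC n).2.
  move=> vC n; split; first exact: (cocycle_in_W_zero b finO uL LE L1).
  by move=> k; exact: (vC (n, k) I).
have ev i : exists n E, window_determined n E /\
    [set v : linfZ | `|cocycle_d f b i.1 v i.2| <= G * K] = [set v : linfZ | E v] /\
    forall y, tame beta L a K y -> E (fun z => Posz (y z)).
  have [n [E [nE EE Ey]]] := cocycle_event (b := b) finO uL LE L1 i.1 i.2 (lexx (G * K)).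
  exists n, E; split => //; split.
    by apply/seteqP; split => v /=; rewrite EE.
  by move=> y [_ _ yK]; exact: Ey.
apply: probability_bigcap1 => i; have [n [E [nE [-> Ey]]]] := ev i.
  exact: measurable_window nE.
exact: supp nE Ey.
Qed.
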